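(* Let $n\ge 1$ be an integer and let $p,q\in[1,\infty]$. Suppose that for some real numbers $\alpha\ge 0$ and $s\ge 0$ there is a constant $K<\infty$ such that for every Schwartz function $\Lambda_0:\mathbb R^n\times\mathbb R^n\to\mathbb C$, with $\Lambda(t,x,y)=e^{\frac{it(\Delta_x+\Delta_y)}{2}}\Lambda_0(x,y)$ for $t\in\mathbb R$ and $x,y\in\mathbb R^n$, one has $$\big\|\,|\nabla|_x^{\alpha}\big(\Lambda(t,x,x)\big)\big\|_{L^p(dt)L^q(dx)}\le K\,\|\Lambda_0\|_{H^s(dx\,dy)}.$$ Then $p\ge 2$ and $q\ge 2$.
   Context: The function $\Lambda(t,\cdot,\cdot)=e^{\frac{it(\Delta_x+\Delta_y)}{2}}\Lambda_0$ is the function on $\mathbb R^{n}\times\mathbb R^n$ whose Fourier transform in $(x,y)$, with dual variables $(\xi,\eta)$ and the convention in which $\nabla_x$ corresponds to multiplication by $i\xi$ and $\nabla_y$ to multiplication by $i\eta$, is $e^{-\frac{it(|\xi|^2+|\eta|^2)}{2}}\widehat{\Lambda_0}(\xi,\eta)$. For each $t$, $\Lambda(t,x,x)$ denotes the restriction to the diagonal, a function of $x\in\mathbb R^n$, and $|\nabla|_x^{\alpha}$ is the Fourier multiplier on $\mathbb R^n$ with symbol $|\xi|^{\alpha}$, applied to the function $x\mapsto\Lambda(t,x,x)$. The mixed norm is $\|f\|_{L^p(dt)L^q(dx)}=\big\|\,\|f(t,\cdot)\|_{L^q(\mathbb R^n)}\big\|_{L^p(\mathbb R)}$ (with values in $[0,\infty]$),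 where $t$ ranges over all of $\mathbb R$. $H^s(dx\,dy)$ is the inhomogeneous $L^2$-based Sobolev space on $\mathbb R^{2n}$. *)

(* Defs.v *)
From HB Require Import structures.
From mathcomp Require Import all_boot all_order all_algebra.
From mathcomp Require Import complex.
From mathcomp Require Import all_classical all_reals all_analysis.

Set Implicit Arguments.
Unset Strict Implicit.
Unset Printing Implicit Defensive.

Import Order.TTheory GRing.Theory Num.Theory.
Import numFieldNormedType.Exports.

Local Open Scope classical_set_scope.
Local Open Scope complex_scope.
Local Open Scope ring_scope.

(* The sigma-algebra on R^n generated by the coordinate functions, as the
   library does for n.-tuple R; for R^n it is the Borel sigma-algebra. *)
Section measurable_rV.
Context {R : realType} (n : nat).

Let coord : 'I_n -> 'rV[R]_n -> R := fun i x => x ord0 i.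

Let rV_set0 : g_sigma_preimage coord set0.
Proof. exact: sigma_algebra0. Qed.

Let rV_setC A : g_sigma_preimage coord A -> g_sigma_preimage coord (~` A).
Proof. exact: sigma_algebraC. Qed.

Let rV_bigcup (F : (set 'rV[R]_n)^nat) :
  (forall i, g_sigma_preimage coord (F i)) ->
  g_sigma_preimage coord (\bigcup_i (F i)).
Proof. exact: sigma_algebra_bigcup. Qed.

HB.instance Definition _ := @isMeasurable.Build
  (measure_tuple_display default_measure_display)
  'rV[R]_n (g_sigma_preimage coord) rV_set0 rV_setC rV_bigcup.

End measurable_rV.

Section lebesgue_rV.
Context {R : realType}.

Lemma measurable_coord_rV n (i : 'I_n) :
  measurable_fun [set: 'rV[R]_n] (fun x : 'rV[R]_n => x ord0 i).
Proof.
move=> _ Y mY; rewrite setTI; apply: sub_sigma_algebra => /=.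
rewrite -bigcup_seq/=; exists i => /=; first by rewrite mem_index_enum.
by exists Y => //; rewrite setTI.
Qed.

Lemma measurable_fun_rV d (T : measurableType d) n (f : T -> 'rV[R]_n) :
  (forall i, measurable_fun [set: T] (fun t => f t ord0 i)) ->
  measurable_fun [set: T] f.
Proof.
move=> mf _ A mA; rewrite setTI.
suff : g_sigma_preimage (fun (i : 'I_n) (x : 'rV[R]_n) => x ord0 i) `<=`
    image_set_system setT f measurable.
  by move=> /(_ A mA); rewrite /image_set_system/= setTI.
apply: smallest_sub.
  exact/sigma_algebra_image/sigma_algebra_measurable.
move=> {mA} {}A; rewrite -bigcup_seq => -[i /= _ [B mB <-]].
rewrite /image_set_system/= setTI setTI.
by rewrite -[X in measurable X]setTI; exact: (mf i).
Qed.

Definition rV_cons n (p : measurableTypeR R * 'rV[R]_n) : 'rV[R]_n.+1 :=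
  row_mx (p.1%:M : 'rV[R]_1) p.2.

Definition rV_uncons n (x : 'rV[R]_n.+1) : measurableTypeR R * 'rV[R]_n :=
  (x ord0 ord0, rsubmx (x : 'rV[R]_(1 + n))).

Lemma rV_consK n : cancel (@rV_cons n) (@rV_uncons n).
Proof.
move=> [a x]; rewrite /rV_cons /rV_uncons /= row_mxKr; congr pair.
transitivity (row_mx (a%:M : 'rV[R]_1) x ord0 (lshift n ord0)).
  by congr (row_mx _ _ _ _); exact/val_inj.
by rewrite row_mxEl mxE eqxx.
Qed.

Lemma measurable_rV_cons n : measurable_fun setT (@rV_cons n).
Proof.
apply: measurable_fun_rV => i; rewrite /rV_cons.
pose M (t : measurableTypeR R * 'rV[R]_n) : 'rV[R]_(1 + n) :=
  row_mx (t.1%:M : 'rV[R]_1) t.2.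
suff : forall k : 'I_(1 + n), measurable_fun setT (fun t => M t ord0 k).
  by apply.
move=> k; case: (split_ordP k) => j ->.
  rewrite (_ : (fun t => _) = fst) //; apply/funext => t.
  by rewrite /M row_mxEl mxE [j]ord1 eqxx.
rewrite (_ : (fun t => _) = (fun x : 'rV[R]_n => x ord0 j) \o snd).
  by apply: measurableT_comp => //; exact: measurable_coord_rV.
by apply/funext => t /=; rewrite /M row_mxEr.
Qed.

Lemma measurable_rV_uncons n : measurable_fun setT (@rV_uncons n).
Proof.
apply: measurable_fun_pair; first exact: measurable_coord_rV.
apply: measurable_fun_rV => i.
rewrite (_ : (fun t => _) = (fun x : 'rV[R]_n.+1 => x ord0 (rshift 1 i))).
  exact: measurable_coord_rV.
by apply/funext => t; rewrite mxE.
Qed.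

(* d(x_0, x_1, ..., x_n) = dx_0 d(x_1, ..., x_n) *)
Definition leb_cons n (mu : {sigma_finite_measure set 'rV[R]_n -> \bar R}) :
    set 'rV[R]_n.+1 -> \bar R :=
  pushforward (@lebesgue_measure R \x mu)%E (@rV_cons n).

Section leb_cons.
Variables (n : nat) (mu : {sigma_finite_measure set 'rV[R]_n -> \bar R}).

Let leb_cons0 : leb_cons mu set0 = 0%E.
Proof. by rewrite /leb_cons /pushforward preimage_set0 measure0. Qed.

Let leb_cons_ge0 A : (0 <= leb_cons mu A)%E.
Proof. by rewrite /leb_cons /pushforward; exact: measure_ge0. Qed.

Let leb_cons_sigma_additive : semi_sigma_additive (leb_cons mu).
Proof.
move=> F mF tF mUF; rewrite /leb_cons /pushforward preimage_bigcup.
apply: measure_semi_sigma_additive.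
- by move=> k; rewrite -[X in measurable X]setTI; exact: measurable_rV_cons.
- apply/trivIsetP => /= i j _ _ ij; rewrite -preimage_setI.
  by move/trivIsetP : tF => /(_ _ _ _ _ ij) ->//; rewrite preimage_set0.
- rewrite -preimage_bigcup -[X in measurable X]setTI.
  exact: measurable_rV_cons.
Qed.

HB.instance Definition _ := isMeasure.Build _ _ _
  (leb_cons mu) leb_cons0 leb_cons_ge0 leb_cons_sigma_additive.

Let leb_cons_sigma_finite : sigma_finite setT (leb_cons mu).
Proof.
have /sigma_finiteP[F [TF ndF Foo]] := sigma_finiteT (@lebesgue_measure R).
have /sigma_finiteP[G [TG ndG Goo]] := sigma_finiteT mu.
exists (fun k => @rV_uncons n @^-1` (F k `*` G k)) => [|k].
  apply/esym; rewrite -subTset => x _.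
  have [i _ Fi] : (\bigcup_i F i) (rV_uncons x).1 by rewrite -TF.
  have [j _ Gj] : (\bigcup_i G i) (rV_uncons x).2 by rewrite -TG.
  exists (maxn i j) => //; split.
    by move: Fi; exact/subsetPset/ndF/leq_maxl.
  by move: Gj; exact/subsetPset/ndG/leq_maxr.
have [mF Fkoo] := Foo k; have [mG Gkoo] := Goo k; split.
  rewrite -[X in measurable X]setTI.
  by apply: measurable_rV_uncons => //; exact: measurableX.
rewrite /leb_cons /pushforward -comp_preimage.
rewrite (_ : _ \o _ = id); last by apply/funext => x; exact: rV_consK.
by rewrite preimage_id product_measure1E// lte_mul_pinfty// ge0_fin_numE.
Qed.

HB.instance Definition _ := Measure_isSigmaFinite.Build _ _ _
  (leb_cons mu) leb_cons_sigma_finite.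

End leb_cons.

(* Lebesgue measure on R^n; R^0 is a point, of mass 1. *)
Fixpoint leb n : {sigma_finite_measure set 'rV[R]_n -> \bar R} :=
  match n with
  | 0 => \d_(0 : 'rV[R]_0)
  | n'.+1 => leb_cons (leb n')
  end.

End lebesgue_rV.

Section definitions.
Context {R : realType}.

Definition dotv n (x y : 'rV[R]_n) : R := \sum_(i < n) x ord0 i * y ord0 i.

(* The Euclidean norm; the library's norm on matrices is the sup norm. *)
Definition enorm n (x : 'rV[R]_n) : R := Num.sqrt (dotv x x).

Definition cnorm (z : R[i]) : R := Normc.normc z.

Definition cis (theta : R) : R[i] := cos theta +i* sin theta.

Definition cintegral n (f : 'rV[R]_n -> R[i]) : R[i] :=
  (\int[leb n]_x complex.Re (f x))%R +i* (\int[leb n]_x complex.Im (f x))%R.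

Definition fourier n (f : 'rV[R]_n -> R[i]) (xi : 'rV[R]_n) : R[i] :=
  cintegral (fun x => cis (- dotv x xi) * f x).

Definition inv_fourier n (g : 'rV[R]_n -> R[i]) (x : 'rV[R]_n) : R[i] :=
  (((2 * pi) ^- n)%:C) * cintegral (fun xi => cis (dotv x xi) * g xi).

Definition fourier_mult n (m f : 'rV[R]_n -> R[i]) : 'rV[R]_n -> R[i] :=
  inv_fourier (fun xi => m xi * fourier f xi).

(* |nabla|^alpha; note that 0 `^ 0 = 1. *)
Definition abs_nabla n (alpha : R) : ('rV[R]_n -> R[i]) -> 'rV[R]_n -> R[i] :=
  fourier_mult (fun xi => (enorm xi `^ alpha)%:C).

(* R^n x R^n is 'rV[R]_(n + n), the pair (x, y) being row_mx x y. *)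
Definition schrodinger n (t : R) :
    ('rV[R]_(n + n) -> R[i]) -> 'rV[R]_(n + n) -> R[i] :=
  fourier_mult (fun zeta =>
    cis (- (t * (enorm (lsubmx zeta) ^+ 2 + enorm (rsubmx zeta) ^+ 2) / 2))).

Definition on_diagonal n (f : 'rV[R]_(n + n) -> R[i]) (x : 'rV[R]_n) : R[i] :=
  f (row_mx x x).

Definition mixed_norm n (p q : \bar R) (f : R -> 'rV[R]_n -> R[i]) : \bar R :=
  ('N[@lebesgue_measure R]_p [ (fun t : measurableTypeR R =>
     'N[leb n]_q [ (fun x => (cnorm (f t x))%:E) ]) ])%E.

(* The factor (2 pi)^-n makes H^0 = L^2 isometrically. *)
Definition sobolev_norm n (s : R) (f : 'rV[R]_n -> R[i]) : \bar R :=
  ((((2 * pi) ^- n)%:E *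
    \int[leb n]_xi ((1 + enorm xi ^+ 2) `^ s * cnorm (fourier f xi) ^+ 2)%:E)
   `^ 2^-1)%E.

(* partials [:: j1; ...; jk] f = d_j1 ... d_jk f *)
Definition partials n (js : seq 'I_n) (f : 'rV[R]_n -> R) : 'rV[R]_n -> R :=
  foldr (fun j g => 'D_(delta_mx ord0 j) g) f js.

(* Smoothness is implied: each partial derivative of f has bounded partial
   derivatives, hence is Lipschitz, so that all of them are continuous. *)
Definition schwartz_real n (f : 'rV[R]_n -> R) : Prop :=
  (forall js j x, derivable (partials js f) x (delta_mx ord0 j)) /\
  (forall js (k : nat), exists C : R, forall x,
     (1 + enorm x) ^+ k * `|partials js f x| <= C).

Definition schwartz n (f : 'rV[R]_n -> R[i]) : Prop :=
  schwartz_real (fun x => complex.Re (f x)) /\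
  schwartz_real (fun x => complex.Im (f x)).

End definitions.

(* Main.v *)
(* The necessity comes from random signs.  Let G(x, y) be the Gaussian
   exp(-(|x|^2 + |y|^2) / 2) and let L_1, ..., L_N be copies of G translated in
   space-time by (t_j, a_j); these are again (complex) Gaussians, hence Schwartz.
   For signs e, put L_e = sum_j e_j L_j, and let F_j be the function
   |nabla|^alpha (L_j(t, x, x)).

   - By orthogonality of the signs, the average over e of the square of the H^s
     norm of L_e is N times a constant.
   - For every j, the average over e of |sum_k e_k F_k| is at least |F_j|, and
     |F_j| >= c0 in a neighbourhood of size delta of its centre (-t_j, a_j).

   So if neighbourhoods of the N centres cover T x X, the estimate forces
   |T|^(1/p) |X|^(1/q) <= C N^(1/2).  Consecutive time translates give |T| ~ N with
   X fixed, hence p >= 2; consecutive space translates give q >= 2.  No decay of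
   F_j away from its centre is needed. *)
Require Import Defs.
From mathcomp Require Import all_boot all_order all_algebra.
From mathcomp Require Import complex.
From mathcomp Require Import all_classical all_reals all_analysis.
From mathcomp Require Import measurable_realfun ess_sup_inf.
From mathcomp Require Import ring lra.

Set Implicit Arguments.
Unset Strict Implicit.
Unset Printing Implicit Defensive.

Import Order.TTheory GRing.Theory Num.Theory.
Import numFieldNormedType.Exports.

Local Open Scope classical_set_scope.
Local Open Scope complex_scope.
Local Open Scope ring_scope.

(** * Complex-valued functions *)

(** All packets belong to one explicit family of Gaussians of complex width [z] with real part 1, on
    which the free flow acts by [z -> z + i t]. Every function that occurs can thus be written down,
    and what is left are Gaussian integrals with complex coefficients. These come from differential
    equations in the coefficients, in place of contour shifts or analytic continuation. The signs
    serve twice. Their orthogonality is used at each frequency separately, so the packets need not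
    be almost orthogonal in [H^s] and their centres may be as close as [delta]. For the lower bound,
    the average of the modulus itself is bounded below, so first moments suffice. Accordingly the
    mixed norm is tested against the indicator of [T x X]: Hoelder turns the estimate into a bound
    for an integral, inside which the sum over signs can be moved. The outcome is [|T| |X| <= C
    N^(1/2) |T|^(1-1/p) |X|^(1-1/q)], which treats infinite exponents on the same footing. *)

Section complex_exponential.
Context {R : realType}.
Implicit Types (z w : R[i]) (a b : R).

Lemma cReD z w : complex.Re (z + w) = complex.Re z + complex.Re w.
Proof. by case: z; case: w. Qed.

Lemma cImD z w : complex.Im (z + w) = complex.Im z + complex.Im w.
Proof. by case: z; case: w. Qed.

Lemma cReM z w :
  complex.Re (z * w) = complex.Re z * complex.Re w - complex.Im z * complex.Im w.
Proof. by case: z; case: w. Qed.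

Lemma cImM z w :
  complex.Im (z * w) = complex.Re z * complex.Im w + complex.Im z * complex.Re w.
Proof. by case: z; case: w. Qed.

Lemma cReN z : complex.Re (- z) = - complex.Re z.
Proof. by case: z. Qed.

Lemma cImN z : complex.Im (- z) = - complex.Im z.
Proof. by case: z. Qed.

Lemma complexP z w :
  complex.Re z = complex.Re w -> complex.Im z = complex.Im w -> z = w.
Proof. by case: z w => [? ?] [? ?] /= -> ->. Qed.

Lemma cRe_sum I (r : seq I) (P : pred I) (F : I -> R[i]) :
  complex.Re (\sum_(i <- r | P i) F i) = \sum_(i <- r | P i) complex.Re (F i).
Proof. by apply: (big_morph _ cReD). Qed.

Lemma cIm_sum I (r : seq I) (P : pred I) (F : I -> R[i]) :
  complex.Im (\sum_(i <- r | P i) F i) = \sum_(i <- r | P i) complex.Im (F i).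
Proof. by apply: (big_morph _ cImD). Qed.

Definition cReImE := (cReD, cImD, cReM, cImM, cReN, cImN).

Definition cexp z : R[i] := (expR (complex.Re z))%:C * cis (complex.Im z).

Lemma Re_cexp z : complex.Re (cexp z) = expR (complex.Re z) * cos (complex.Im z).
Proof. by rewrite /cexp /cis cReM /= mul0r subr0. Qed.

Lemma Im_cexp z : complex.Im (cexp z) = expR (complex.Re z) * sin (complex.Im z).
Proof. by rewrite /cexp /cis cImM /= mul0r addr0. Qed.

Lemma cexpD z w : cexp (z + w) = cexp z * cexp w.
Proof.
apply: complexP; rewrite !(Re_cexp, Im_cexp, cReImE) expRD ?cosD ?sinD; ring.
Qed.

Lemma cexp0 : cexp 0 = 1.
Proof. by apply: complexP; rewrite !(Re_cexp, Im_cexp) /= expR0 ?cos0 ?sin0 mul1r. Qed.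

Lemma cis_cexp a : cis a = cexp (0 +i* a).
Proof. by apply: complexP; rewrite ?(Re_cexp, Im_cexp) /= expR0 mul1r. Qed.

Lemma cexp_sum I (r : seq I) (P : pred I) (F : I -> R[i]) :
  cexp (\sum_(i <- r | P i) F i) = \prod_(i <- r | P i) cexp (F i).
Proof. by apply: (big_morph cexp cexpD cexp0). Qed.

Lemma cnormE z : cnorm z = Num.sqrt (complex.Re z ^+ 2 + complex.Im z ^+ 2).
Proof. by case: z. Qed.

Lemma cnorm_ge0 z : 0 <= cnorm z.
Proof. by rewrite cnormE sqrtr_ge0. Qed.

Lemma cnorm2 z : cnorm z ^+ 2 = complex.Re z ^+ 2 + complex.Im z ^+ 2.
Proof. by rewrite cnormE sqr_sqrtr // addr_ge0 ?sqr_ge0. Qed.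

Lemma cnormM z w : cnorm (z * w) = cnorm z * cnorm w.
Proof. exact: Normc.normcM. Qed.

Lemma cnormX z n : cnorm (z ^+ n) = cnorm z ^+ n.
Proof.
elim: n => [|n IH]; first by rewrite !expr0 /cnorm Normc.normc1.
by rewrite !exprS cnormM IH.
Qed.

Lemma cnormV z : cnorm z^-1 = (cnorm z)^-1.
Proof. exact: Normc.normcV. Qed.

Lemma cnormD z w : cnorm (z + w) <= cnorm z + cnorm w.
Proof. exact: le_normcD. Qed.

Lemma cnorm_sum I (r : seq I) (P : pred I) (F : I -> R[i]) :
  cnorm (\sum_(i <- r | P i) F i) <= \sum_(i <- r | P i) cnorm (F i).
Proof.
elim/big_rec2 : _ => [|i x y _ h]; first by rewrite /cnorm Normc.normc0.
by rewrite (le_trans (cnormD _ _)) // lerD2l.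
Qed.

Lemma cnorm_real a : cnorm a%:C = `|a|.
Proof. by rewrite cnormE /= expr0n /= addr0 sqrtr_sqr. Qed.

Lemma cnorm_cexp z : cnorm (cexp z) = expR (complex.Re z).
Proof.
rewrite cnormE Re_cexp Im_cexp !exprMn -mulrDr cos2Dsin2 mulr1.
by rewrite sqrtr_sqr ger0_norm // expR_ge0.
Qed.

Lemma cnorm_cis a : cnorm (cis a) = 1.
Proof. by rewrite cis_cexp cnorm_cexp expR0. Qed.

Lemma Re_le_cnorm z : `|complex.Re z| <= cnorm z.
Proof. by rewrite cnormE -sqrtr_sqr ler_wsqrtr // lerDl sqr_ge0. Qed.

Lemma Im_le_cnorm z : `|complex.Im z| <= cnorm z.
Proof. by rewrite cnormE -sqrtr_sqr ler_wsqrtr // lerDr sqr_ge0. Qed.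

Lemma cnorm_eq0 z : (cnorm z == 0) = (z == 0).
Proof.
apply/eqP/eqP => [/Normc.eq0_normc //|->]; exact: Normc.normc0.
Qed.

Lemma cReV z : complex.Re z^-1 = complex.Re z / cnorm z ^+ 2.
Proof. by rewrite cnorm2; case: z. Qed.

Lemma cReV_gt0 z : 0 < complex.Re z -> 0 < complex.Re z^-1.
Proof.
move=> z0; rewrite cReV divr_gt0 // cnorm2.
by rewrite ltr_wpDr ?sqr_ge0 // exprn_gt0.
Qed.

Lemma Re_gt0_neq0 z : 0 < complex.Re z -> z != 0.
Proof. by apply: contraTneq => ->; rewrite /= ltxx. Qed.

End complex_exponential.

Section complex_measurable.
Context {R : realType} d (T : measurableType d).
Implicit Types (f g : T -> R[i]) (c : R[i]).

Definition cmeas f :=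
  measurable_fun setT (fun x => complex.Re (f x)) /\
  measurable_fun setT (fun x => complex.Im (f x)).

Lemma cmeas_cst c : cmeas (fun=> c).
Proof. by split; exact: measurable_cst. Qed.

Lemma cmeasD f g : cmeas f -> cmeas g -> cmeas (fun x => f x + g x).
Proof.
move=> [f1 f2] [g1 g2]; split.
  by under eq_fun do rewrite cReD; exact: measurable_funD.
by under eq_fun do rewrite cImD; exact: measurable_funD.
Qed.

Lemma cmeasM f g : cmeas f -> cmeas g -> cmeas (fun x => f x * g x).
Proof.
move=> [f1 f2] [g1 g2]; split.
  under eq_fun do rewrite cReM.
  by apply: measurable_funB; exact: measurable_funM.
under eq_fun do rewrite cImM.
by apply: measurable_funD; exact: measurable_funM.
Qed.

Lemma cmeas_sum I (r : seq I) (F : I -> T -> R[i]) :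
  (forall i, cmeas (F i)) -> cmeas (fun x => \sum_(i <- r) F i x).
Proof.
move=> mF; elim: r => [|i r IH].
  by under eq_fun do rewrite big_nil; exact: cmeas_cst.
by under eq_fun do rewrite big_cons; exact: cmeasD.
Qed.

Lemma cmeas_prod I (r : seq I) (F : I -> T -> R[i]) :
  (forall i, cmeas (F i)) -> cmeas (fun x => \prod_(i <- r) F i x).
Proof.
move=> mF; elim: r => [|i r IH].
  by under eq_fun do rewrite big_nil; exact: cmeas_cst.
by under eq_fun do rewrite big_cons; exact: cmeasM.
Qed.

Lemma cmeasX f n : cmeas f -> cmeas (fun x => f x ^+ n).
Proof.
move=> mf; elim: n => [|n IH].
  by under eq_fun do rewrite expr0; exact: cmeas_cst.
by under eq_fun do rewrite exprS; exact: cmeasM.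
Qed.

Lemma cmeas_real (f : T -> R) :
  measurable_fun setT f -> cmeas (fun x => (f x)%:C).
Proof. by move=> mf; split => //=; exact: measurable_cst. Qed.

Lemma cmeasN f : cmeas f -> cmeas (fun x => - f x).
Proof.
move=> [f1 f2]; split.
  by under eq_fun do rewrite cReN; exact: measurable_funN.
by under eq_fun do rewrite cImN; exact: measurable_funN.
Qed.

Lemma cmeas_cexp f : cmeas f -> cmeas (fun x => cexp (f x)).
Proof.
move=> [f1 f2]; split.
  under eq_fun do rewrite Re_cexp; apply: measurable_funM.
    exact: measurableT_comp.
  apply: measurableT_comp => //; apply: continuous_measurable_fun.
  exact: continuous_cos.
under eq_fun do rewrite Im_cexp; apply: measurable_funM.
  exact: measurableT_comp.
apply: measurableT_comp => //; apply: continuous_measurable_fun.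
exact: continuous_sin.
Qed.

Lemma measurable_cnorm2 f : cmeas f -> measurable_fun setT (fun x => cnorm (f x) ^+ 2).
Proof.
move=> [f1 f2]; under eq_fun do rewrite cnorm2.
by apply: measurable_funD; exact: measurable_funX.
Qed.

Lemma measurable_cnorm f : cmeas f -> measurable_fun setT (fun x => cnorm (f x)).
Proof.
move=> mf; rewrite (_ : (fun x => _) = (fun x => Num.sqrt (cnorm (f x) ^+ 2))).
  have ms : measurable_fun setT (@Num.sqrt R).
    by apply: continuous_measurable_fun; exact: sqrt_continuous.
  exact: (measurableT_comp ms (measurable_cnorm2 mf)).
by apply/funext => x; rewrite sqrtr_sqr ger0_norm // cnorm_ge0.
Qed.

End complex_measurable.

Lemma cmeas_comp {R : realType} d d' (T : measurableType d) (U : measurableType d')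
    (g : U -> T) (f : T -> R[i]) :
  cmeas f -> measurable_fun setT g -> cmeas (f \o g).
Proof.
move=> [f1 f2] mg; split.
  exact: (measurableT_comp f1 mg).
exact: (measurableT_comp f2 mg).
Qed.

Section complex_integral.
Context {R : realType} d (T : measurableType d) (mu : {measure set T -> \bar R}).
Implicit Types (f g : T -> R[i]) (c : R[i]) (G : T -> R).

Definition cint f : R[i] :=
  (\int[mu]_x complex.Re (f x))%R +i* (\int[mu]_x complex.Im (f x))%R.

Definition cintegrable f :=
  mu.-integrable setT (fun x => (complex.Re (f x))%:E) /\
  mu.-integrable setT (fun x => (complex.Im (f x))%:E).

Lemma le_integrableT (f G : T -> R) : measurable_fun setT f ->
  mu.-integrable setT (EFin \o G) -> (forall x, `|f x| <= G x) ->
  mu.-integrable setT (EFin \o f).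
Proof.
move=> mf iG fG; apply: le_integrable iG => //; first exact/measurable_EFinP.
by move=> x _ /=; rewrite lee_fin (le_trans (fG x)) // ler_norm.
Qed.

Lemma integrable_scale (k : R) (f : T -> R) : mu.-integrable setT (EFin \o f) ->
  mu.-integrable setT (EFin \o (fun x => k * f x)).
Proof.
move=> fi; rewrite (_ : _ \o _ = (fun x => k%:E * (EFin \o f) x)%E).
  exact: integrableZl.
by apply/funext => x.
Qed.

Lemma cintegrable_le f G : cmeas f -> mu.-integrable setT (EFin \o G) ->
  (forall x, cnorm (f x) <= G x) -> cintegrable f.
Proof.
move=> [f1 f2] iG fG; split; apply: (le_integrableT _ iG) => // x.
  exact: le_trans (Re_le_cnorm _) (fG x).
exact: le_trans (Im_le_cnorm _) (fG x).
Qed.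

Lemma cintegrable_meas f : cintegrable f -> cmeas f.
Proof.
move=> [/measurable_int/measurable_EFinP f1 /measurable_int/measurable_EFinP f2].
by split.
Qed.

Lemma cintegrable_norm f : cintegrable f ->
  mu.-integrable setT (fun x => (cnorm (f x))%:E).
Proof.
move=> fi; have mf := cintegrable_meas fi; case: fi => f1 f2.
apply: (@le_integrableT _ (fun x => `|complex.Re (f x)| + `|complex.Im (f x)|)).
- exact: measurable_cnorm.
- rewrite (_ : _ \o _ = (fun x => `|(complex.Re (f x))%:E| + `|(complex.Im (f x))%:E|)%E) //.
  by apply: integrableD => //; exact: integrable_abse.
- move=> x; rewrite ger0_norm ?cnorm_ge0 // cnormE.
  rewrite -[leRHS]ger0_norm ?addr_ge0 // -sqrtr_sqr ler_wsqrtr //.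
  rewrite sqrrD !real_normK ?num_real // lerD2r lerDl.
  by rewrite mulrn_wge0 // mulr_ge0.
Qed.

Lemma cintegrable0 : cintegrable (fun=> 0).
Proof. by split; exact: integrable0. Qed.

Lemma cintegrableD f g : cintegrable f -> cintegrable g ->
  cintegrable (fun x => f x + g x).
Proof.
move=> [f1 f2] [g1 g2]; split.
  by under eq_fun do rewrite cReD EFinD; exact: integrableD.
by under eq_fun do rewrite cImD EFinD; exact: integrableD.
Qed.

Lemma cintegrableZ c f : cintegrable f -> cintegrable (fun x => c * f x).
Proof.
move=> [f1 f2]; split.
  under eq_fun do rewrite cReM EFinB !EFinM.
  by apply: integrableB => //; exact: integrableZl.
under eq_fun do rewrite cImM EFinD !EFinM.
by apply: integrableD => //; exact: integrableZl.
Qed.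

Lemma cintD f g : cintegrable f -> cintegrable g ->
  cint (fun x => f x + g x) = cint f + cint g.
Proof.
move=> [f1 f2] [g1 g2]; apply: complexP; rewrite cReImE /=.
  by under eq_Rintegral do rewrite cReD; rewrite RintegralD.
by under eq_Rintegral do rewrite cImD; rewrite RintegralD.
Qed.

Lemma cintZ c f : cintegrable f -> cint (fun x => c * f x) = c * cint f.
Proof.
move=> [f1 f2]; apply: complexP; rewrite cReImE /=.
  under eq_Rintegral do rewrite cReM.
  rewrite RintegralB //; [|exact: integrable_scale|exact: integrable_scale].
  by rewrite !RintegralZl.
under eq_Rintegral do rewrite cImM.
rewrite RintegralD //; [|exact: integrable_scale|exact: integrable_scale].
by rewrite !RintegralZl.
Qed.

Lemma cint0 : cint (fun=> 0) = 0.
Proof. by rewrite /cint /Rintegral integral0. Qed.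

Lemma cintegrable_sum I (r : seq I) (F : I -> T -> R[i]) :
  (forall i, cintegrable (F i)) -> cintegrable (fun x => \sum_(i <- r) F i x).
Proof.
move=> mF; elim: r => [|i r IH].
  by under eq_fun do rewrite big_nil; exact: cintegrable0.
by under eq_fun do rewrite big_cons; exact: cintegrableD.
Qed.

Lemma cint_sum I (r : seq I) (F : I -> T -> R[i]) :
  (forall i, cintegrable (F i)) ->
  cint (fun x => \sum_(i <- r) F i x) = \sum_(i <- r) cint (F i).
Proof.
move=> mF; elim: r => [|i r IH].
  by rewrite big_nil -[RHS]cint0; congr cint; apply/funext => x; rewrite big_nil.
under eq_fun do rewrite big_cons.
by rewrite cintD // ?IH ?big_cons //; exact: cintegrable_sum.
Qed.

Lemma eq_cint f g : f =1 g -> cint f = cint g.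
Proof. by move=> /funext ->. Qed.

End complex_integral.

(** * Vanishing integrals of derivatives *)

Section gaussian_line.
Context {R : realType}.
Notation mu := (@lebesgue_measure R).

(** The decay of [F] makes the boundary terms on [[-k-1, k+1]] of order [1/k], and integrability of
    [f] gives the limit by dominated convergence. This takes the place of integration by parts in
    the moment identities. *)
Lemma integral_derive_eq0 (F f : R -> R) (C : R) :
  (forall x : R, is_derive x (1 : R) F (f x)) -> continuous f ->
  mu.-integrable setT (EFin \o f) ->
  (forall x, (1 + `|x|) * `|F x| <= C) ->
  (\int[mu]_x f x = 0)%R.
Proof.
move=> dF cf fi FC.
have cF : continuous F.
  move=> x; apply: differentiable_continuous; apply/derivable1_diffP.
  by have [] := dF x.
pose I (k : nat) : set R := `[- (k.+1%:R), k.+1%:R]%classic.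
have FTC k : (\int[mu]_(x in I k) (f x)%:E = (F k.+1%:R)%:E - (F (- k.+1%:R))%:E)%E.
  have k0 : - k.+1%:R < k.+1%:R :> R by rewrite gtrN.
  apply: continuous_FTC2 => //.
  - exact: continuous_subspaceT.
  - split; first by move=> x _; have [] := dF x.
      exact: cvg_at_right_filter (cF _).
    exact: cvg_at_left_filter (cF _).
  - by move=> x _; rewrite derive1E; have [] := dF x.
have lim0 : (\int[mu]_(x in I k) (f x)%:E)%E @[k --> \oo] --> 0%E.
  under eq_fun do rewrite FTC -EFinB.
  apply: cvg_EFin; first exact: nearW.
  have FC' x : `|F x| <= C / (1 + `|x|).
    by rewrite ler_pdivlMr ?ltr_pwDl // mulrC FC.
  have C0 : 0 <= C by apply: le_trans (FC 0); rewrite mulr_ge0 ?addr_ge0.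
  have bnd s k : s = 1 \/ s = -1 -> `|F (s * k.+1%:R)| <= C * k.+1%:R^-1.
    move=> hs; apply: (le_trans (FC' _)).
    rewrite ler_wpM2l // lef_pV2 ?posrE ?ltr_pwDl //.
    have s1 : `|s| = 1 by case: hs => ->; rewrite ?normrN1 ?normr1.
    by rewrite normrM s1 mul1r ger0_norm // lerDr.
  apply: norm_cvg0.
  apply: (@squeeze_cvgr _ _ _ _ (cst 0) (fun k => (C * 2) * k.+1%:R^-1)).
  - apply: nearW => k; rewrite normr_ge0 /=.
    apply: (le_trans (ler_normB _ _)).
    have h1 := bnd 1 k (or_introl erefl); have h2 := bnd (-1) k (or_intror erefl).
    rewrite mul1r in h1; rewrite mulN1r in h2.
    by rewrite mulrAC mulr2n mulrDr mulr1 lerD.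
  - exact: cvg_cst.
  - rewrite -[X in _ --> X](mulr0 (C * 2)); apply: cvgM; first exact: cvg_cst.
    exact: cvg_harmonic.
have lim1 : (\int[mu]_(x in I k) (f x)%:E)%E @[k --> \oo] --> (\int[mu]_x (f x)%:E)%E.
  under eq_fun do rewrite integral_mkcond.
  have mf : measurable_fun setT (EFin \o f) by exact: measurable_int fi.
  apply: (@dominated_cvg _ _ _ mu setT measurableT
    (fun k => (EFin \o f) \_ (I k)) (EFin \o f) (fun x => `|(f x)%:E|)%E) => //.
  - move=> k; apply/(measurable_restrictT _ _).1; first exact: measurable_itv.
    exact: measurable_funTS.
  - move=> x _; apply: cvg_near_cst.
    near=> k; rewrite /patch mem_set // /I /= in_itv /= -ler_norml.
    near: k; have [N hN] : exists N : nat, `|x| <= N%:R.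
      exists (Num.truncn `|x|).+1; exact/ltW/truncnS_gt.
    exists N => // k /= Nk; rewrite (le_trans hN) // ler_nat.
    exact: leqW.
  - exact: integrable_abse.
  - move=> k x _; rewrite /patch; case: ifP => _; first exact: lexx.
    by rewrite abse0 abse_ge0.
have := cvg_unique _ lim0 lim1; rewrite /Rintegral => <- //.
Unshelve. all: by end_near. Qed.

End gaussian_line.

Section complex_derivative.
Context {R : realType}.
Implicit Types (f g : R -> R[i]) (x : R) (l m c : R[i]).

Definition cderive f x l :=
  is_derive x (1 : R) (fun y => complex.Re (f y)) (complex.Re l) /\
  is_derive x (1 : R) (fun y => complex.Im (f y)) (complex.Im l).

Lemma cderive_cst c x : cderive (fun=> c) x 0.
Proof. by split; exact: is_derive_cst. Qed.

Lemma cderive_id x : cderive (fun y => y%:C) x 1.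
Proof. by split => /=; [exact: is_derive_id|exact: is_derive_cst]. Qed.

Lemma eq_cderive f x l m : cderive f x l -> l = m -> cderive f x m.
Proof. by move=> + <-. Qed.

Lemma cderiveD f g x l m : cderive f x l -> cderive g x m ->
  cderive (fun y => f y + g y) x (l + m).
Proof.
move=> [f1 f2] [g1 g2]; split.
  by rewrite cReD; under eq_fun do rewrite cReD; exact: is_deriveD.
by rewrite cImD; under eq_fun do rewrite cImD; exact: is_deriveD.
Qed.

Lemma cderiveM f g x l m : cderive f x l -> cderive g x m ->
  cderive (fun y => f y * g y) x (l * g x + f x * m).
Proof.
move=> [f1 f2] [g1 g2]; split.
  rewrite cReD !cReM; under eq_fun do rewrite cReM.
  apply: (is_derive_eq (is_deriveB (is_deriveM f1 g1) (is_deriveM f2 g2))).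
  by rewrite /GRing.scale /=; ring.
rewrite cImD !cImM; under eq_fun do rewrite cImM.
apply: (is_derive_eq (is_deriveD (is_deriveM f1 g2) (is_deriveM f2 g1))).
by rewrite /GRing.scale /=; ring.
Qed.

Lemma cderiveZ c f x l : cderive f x l -> cderive (fun y => c * f y) x (c * l).
Proof.
move=> fl; apply: eq_cderive; first exact: cderiveM (cderive_cst c x) fl.
by rewrite mul0r add0r.
Qed.

Lemma cderive_sqr f x l : cderive f x l ->
  cderive (fun y => f y ^+ 2) x (2 * l * f x).
Proof.
move=> fl; under eq_fun do rewrite expr2; apply: eq_cderive.
  exact: (cderiveM fl fl).
by ring.
Qed.

Lemma cderive_cexp f x l : cderive f x l ->
  cderive (fun y => cexp (f y)) x (l * cexp (f x)).
Proof.
move=> [f1 f2].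
have de : is_derive x (1:R) (fun y => expR (complex.Re (f y)))
    (complex.Re l * expR (complex.Re (f x))).
  by rewrite mulrC; exact: (is_derive1_comp (is_derive_expR _) f1).
have dc : is_derive x (1:R) (fun y => cos (complex.Im (f y)))
    (complex.Im l * - sin (complex.Im (f x))).
  by rewrite mulrC; exact: (is_derive1_comp (is_derive_cos _) f2).
have ds : is_derive x (1:R) (fun y => sin (complex.Im (f y)))
    (complex.Im l * cos (complex.Im (f x))).
  by rewrite mulrC; exact: (is_derive1_comp (is_derive_sin _) f2).
split.
  rewrite cReM Re_cexp Im_cexp; under eq_fun do rewrite Re_cexp.
  apply: (is_derive_eq (is_deriveM de dc)).
  by rewrite /GRing.scale /=; ring.
rewrite cImM Re_cexp Im_cexp; under eq_fun do rewrite Im_cexp.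
apply: (is_derive_eq (is_deriveM de ds)).
by rewrite /GRing.scale /=; ring.
Qed.

Lemma cderive0_cst f x y : (forall u, cderive f u 0) -> f x = f y.
Proof.
move=> df; apply: complexP.
  by apply: (is_derive_0_is_cst (f := fun u => complex.Re (f u))) => u; case: (df u).
by apply: (is_derive_0_is_cst (f := fun u => complex.Im (f u))) => u; case: (df u).
Qed.

Lemma cderive_continuous f : (forall x, exists l, cderive f x l) ->
  continuous (fun x => complex.Re (f x)) /\ continuous (fun x => complex.Im (f x)).
Proof.
move=> df; split => x; apply: differentiable_continuous; apply/derivable1_diffP;
  by have [l [[? _] [? _]]] := df x.
Qed.

Lemma cint_derive_eq0 f g (C : R) :
  (forall x, cderive f x (g x)) -> (forall x, exists l, cderive g x l) ->
  cintegrable (@lebesgue_measure R) g ->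
  (forall x, (1 + `|x|) * cnorm (f x) <= C) ->
  cint (@lebesgue_measure R) g = 0.
Proof.
move=> df /cderive_continuous[cg1 cg2] [g1 g2] fC; apply: complexP => /=.
  apply: (integral_derive_eq0 (F := fun x => complex.Re (f x)) (C := C)) => //.
    by move=> x; case: (df x).
  move=> x; apply: le_trans (fC x); rewrite ler_wpM2l ?addr_ge0 //.
  exact: Re_le_cnorm.
apply: (integral_derive_eq0 (F := fun x => complex.Im (f x)) (C := C)) => //.
  by move=> x; case: (df x).
move=> x; apply: le_trans (fC x); rewrite ler_wpM2l ?addr_ge0 //.
exact: Im_le_cnorm.
Qed.

End complex_derivative.

(** * Gaussian integrals on the line *)

Section gaussian_bounds.
Context {R : realType}.
Notation mu := (@lebesgue_measure R).

(** Half of the Gaussian rate absorbs both the polynomial and the linear exponent. After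
    [(1 + x) ^+ m <= expR (m * x)], completing the square leaves a gap
    [((K + m) - a * x) ^+ 2 / (2 * a)] between the exponents, whence the constant. *)
Lemma expR_sqr_bound (a K : R) (m : nat) : 0 < a ->
  exists2 C, 0 < C & forall x, 0 <= x ->
    (1 + x) ^+ m * expR (- a * x ^+ 2 + K * x) <= C * expR (- (a / 2) * x ^+ 2).
Proof.
move=> a0; exists (expR ((K + m%:R) ^+ 2 / (2 * a))); first exact: expR_gt0.
move=> x x0.
have h1 : (1 + x) ^+ m <= expR (m%:R * x).
  by rewrite expRM_natl lerXn2r ?nnegrE ?expR_ge0 ?addr_ge0 // expR_ge1Dx.
apply: (le_trans (ler_wpM2r (expR_ge0 _) h1)).
rewrite -!expRD ler_expR -subr_ge0.
have -> : (K + m%:R) ^+ 2 / (2 * a) + - (a / 2) * x ^+ 2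
    - (m%:R * x + (- a * x ^+ 2 + K * x)) = ((K + m%:R) - a * x) ^+ 2 / (2 * a).
  by field; rewrite gt_eqF.
by rewrite divr_ge0 ?sqr_ge0 // mulr_ge0 // ltW.
Qed.

(** Up to its peak value, the integrand is the normal density of variance [(2 * a)^-1], whose mass
    is 1. *)
Lemma integral_expR_sqr (a : R) : 0 < a ->
  mu.-integrable setT (EFin \o (fun x => expR (- a * x ^+ 2))) /\
  (\int[mu]_x expR (- a * x ^+ 2))%R = Num.sqrt (pi / a).
Proof.
move=> a0; pose s := Num.sqrt ((2 * a)^-1).
have a20 : 0 < (2 * a)^-1 :> R by rewrite invr_gt0 mulr_gt0.
have s0 : 0 < s by rewrite sqrtr_gt0.
have s2 : s ^+ 2 = (2 * a)^-1 by rewrite sqr_sqrtr // ltW.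
pose pk := normal_peak s.
have pk0 : 0 < pk by apply: normal_peak_gt0; rewrite gt_eqF.
have E x : expR (- a * x ^+ 2) = pk^-1 * normal_pdf 0 s x.
  rewrite normal_pdfE ?gt_eqF // mulrA mulVf ?gt_eqF // mul1r /normal_fun subr0.
  congr expR; rewrite s2 mulr2n; field; rewrite gt_eqF //.
have I := integrable_normal_pdf 0 s.
rewrite (_ : (fun x => expR (- a * x ^+ 2)) = (fun x => pk^-1 * normal_pdf 0 s x)); last first.
  by apply/funext.
split; first exact: integrable_scale.
rewrite (RintegralZl _ _ I) // /Rintegral integral_normal_pdf /= mulr1 /pk /normal_peak invrK.
congr Num.sqrt; rewrite s2 mulr2n; field; rewrite gt_eqF //.
Qed.

End gaussian_bounds.

Section complex_gaussian.
Context {R : realType}.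
Notation mu := (@lebesgue_measure R).
Implicit Types (w k : R[i]) (x u : R).

(* The linear coefficient [k] is complex, so that translates, modulations and
   Fourier transforms of Gaussians are all integrals of [cgauss]. *)
Definition cgauss w k x : R[i] := cexp (- (w / 2) * x%:C ^+ 2 + k * x%:C).

Lemma cnorm_cgauss w k x :
  cnorm (cgauss w k x) = expR (- (complex.Re w / 2) * x ^+ 2 + complex.Re k * x).
Proof.
rewrite cnorm_cexp; congr expR; case: w k => [a b] [c d].
have -> : (a +i* b) / 2 = (a / 2) +i* (b / 2).
  rewrite -[2 : R[i]]/((1 + 1) +i* (0 + 0)).
  by apply: complexP => /=; field.
by rewrite expr2 /=; ring.
Qed.

Lemma cnorm_cgauss_le w k x :
  cnorm (cgauss w k x) <= expR (- (complex.Re w / 2) * `|x| ^+ 2 + cnorm k * `|x|).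
Proof.
rewrite cnorm_cgauss ler_expR real_normK ?num_real // lerD2l.
apply: (le_trans (ler_norm _)).
by rewrite normrM ler_wpM2r // Re_le_cnorm.
Qed.

Lemma cmeas_id : cmeas (fun x : measurableTypeR R => x%:C).
Proof. exact: cmeas_real. Qed.

Lemma cmeas_cgauss w k : cmeas (fun x : measurableTypeR R => cgauss w k x).
Proof.
apply: cmeas_cexp; apply: cmeasD.
  by apply: cmeasM; [exact: cmeas_cst|apply: cmeasX; exact: cmeas_id].
by apply: cmeasM; [exact: cmeas_cst|exact: cmeas_id].
Qed.

Lemma cderive_cgauss w k x :
  cderive (cgauss w k) x ((- w * x%:C + k) * cgauss w k x).
Proof.
apply: cderive_cexp; apply: eq_cderive.
  apply: cderiveD; first exact: (cderiveZ _ (cderive_sqr (cderive_id _))).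
  exact: (cderiveZ _ (cderive_id _)).
by field.
Qed.

Lemma cintegrable_poly_cgauss (p : R -> R[i]) w k (K : R) (m : nat) :
  0 < complex.Re w -> cmeas (p : measurableTypeR R -> R[i]) ->
  (forall x, cnorm (p x) <= K * (1 + `|x|) ^+ m) ->
  cintegrable mu (fun x => p x * cgauss w k x).
Proof.
move=> w0 mp pK.
have [C C0 hC] := expR_sqr_bound (cnorm k) m (divr_gt0 w0 (ltr0Sn R 1)).
have K0 : 0 <= K by apply: le_trans (cnorm_ge0 (p 0)) (le_trans (pK 0) _);
  rewrite normr0 addr0 expr1n mulr1.
apply: (@cintegrable_le R _ (measurableTypeR R) mu _
  (fun x => (K * C) * expR (- (complex.Re w / 2 / 2) * x ^+ 2))).
- by apply: cmeasM => //; exact: cmeas_cgauss.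
- apply: integrable_scale; apply: (integral_expR_sqr _).1.
  by rewrite !divr_gt0.
- move=> x; rewrite cnormM.
  apply: (le_trans (ler_pM (cnorm_ge0 _) (cnorm_ge0 _) (pK x) (cnorm_cgauss_le w k x))).
  by rewrite -[leLHS]mulrA -[leRHS]mulrA ler_wpM2l // -[x ^+ 2]real_normK ?num_real // hC.
Qed.

Lemma cintegrable_cgauss w k : 0 < complex.Re w -> cintegrable mu (cgauss w k).
Proof.
move=> w0; have := @cintegrable_poly_cgauss (fun=> 1) w k 1 0 w0 (cmeas_cst _ _).
under [X in cintegrable _ X]eq_fun do rewrite mul1r; apply => x.
by rewrite /cnorm Normc.normc1 mulr1.
Qed.

Lemma cintegrable_x_cgauss w k : 0 < complex.Re w ->
  cintegrable mu (fun x => x%:C * cgauss w k x).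
Proof.
move=> w0; apply: (@cintegrable_poly_cgauss _ w k 1 1) => //; first exact: cmeas_id.
by move=> x; rewrite cnorm_real mul1r expr1 lerDr.
Qed.

Lemma cintegrable_x2_cgauss w k : 0 < complex.Re w ->
  cintegrable mu (fun x => x%:C ^+ 2 * cgauss w k x).
Proof.
move=> w0; apply: (@cintegrable_poly_cgauss _ w k 1 2) => //.
  exact/cmeasX/cmeas_id.
move=> x; rewrite cnormX cnorm_real mul1r.
by rewrite lerXn2r ?nnegrE ?addr_ge0 // lerDr.
Qed.

Lemma cgauss_decay w k (m : nat) : 0 < complex.Re w ->
  exists C, forall x, (1 + `|x|) ^+ m * cnorm (cgauss w k x) <= C.
Proof.
move=> w0.
have [C C0 hC] := expR_sqr_bound (cnorm k) m (divr_gt0 w0 (ltr0Sn R 1)).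
exists C => x; rewrite (le_trans (ler_wpM2l _ (cnorm_cgauss_le w k x))) ?exprn_ge0 ?addr_ge0 //.
rewrite (le_trans (hC _ _)) // ler_piMr // ?(ltW C0) // -expR0 ler_expR mulNr oppr_le0.
by rewrite mulr_ge0 ?sqr_ge0 // ltW // !divr_gt0.
Qed.

(** The derivative [(- w * x + k) * cgauss w k x] of the Gaussian integrates to zero. *)
Lemma gaussian_moment1 w k : 0 < complex.Re w ->
  w * cint mu (fun x => x%:C * cgauss w k x) = k * cint mu (cgauss w k).
Proof.
move=> w0; have [C hC] := cgauss_decay k 1 w0.
have I1 := cintegrable_x_cgauss k w0; have I0 := cintegrable_cgauss k w0.
pose g x := - w * (x%:C * cgauss w k x) + k * cgauss w k x.
have gi : cint mu g = - w * cint mu (fun x => x%:C * cgauss w k x) + k * cint mu (cgauss w k).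
  by rewrite cintD; [rewrite !cintZ|exact: cintegrableZ|exact: cintegrableZ].
suff : cint mu g = 0.
  by rewrite gi mulNr => /eqP; rewrite addrC subr_eq0 => /eqP.
apply: (@cint_derive_eq0 _ (cgauss w k) _ C).
- by move=> x; rewrite /g mulrA -mulrDl; exact: cderive_cgauss.
- move=> x; eexists; apply: cderiveD; apply: cderiveZ; last exact: cderive_cgauss.
  by apply: cderiveM; [exact: cderive_id|exact: cderive_cgauss].
- by apply: cintegrableD; exact: cintegrableZ.
- by move=> x; have := hC x; rewrite expr1.
Qed.

(** Here the derivative of [x * cgauss w k x] integrates to zero. At [k = 0] this expresses the
    second moment by the integral itself, which is what closes the equation in [gaussian_sqr]. *)
Lemma gaussian_moment2 w k : 0 < complex.Re w ->
  w * cint mu (fun x => x%:C ^+ 2 * cgauss w k x) =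
  cint mu (cgauss w k) + k * cint mu (fun x => x%:C * cgauss w k x).
Proof.
move=> w0; have [C hC] := cgauss_decay k 2 w0.
have I2 := cintegrable_x2_cgauss k w0.
have I1 := cintegrable_x_cgauss k w0; have I0 := cintegrable_cgauss k w0.
pose g x := (cgauss w k x + k * (x%:C * cgauss w k x)) + - w * (x%:C ^+ 2 * cgauss w k x).
have gi : cint mu g = (cint mu (cgauss w k) + k * cint mu (fun x => x%:C * cgauss w k x))
    + - w * cint mu (fun x => x%:C ^+ 2 * cgauss w k x).
  rewrite cintD; [|by apply: cintegrableD => //; exact: cintegrableZ|exact: cintegrableZ].
  by rewrite cintD ?cintZ //; exact: cintegrableZ.
suff : cint mu g = 0.
  by rewrite gi mulNr => /eqP; rewrite subr_eq0 => /eqP.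
apply: (@cint_derive_eq0 _ (fun x => x%:C * cgauss w k x) _ C).
- move=> x; apply: eq_cderive.
    by apply: cderiveM; [exact: cderive_id|exact: cderive_cgauss].
  by rewrite /g; ring.
- move=> x; eexists; apply: cderiveD.
    apply: cderiveD; first exact: cderive_cgauss.
    by apply/cderiveZ/cderiveM; [exact: cderive_id|exact: cderive_cgauss].
  by apply/cderiveZ/cderiveM; [exact/cderive_sqr/cderive_id|exact: cderive_cgauss].
- apply: cintegrableD; last exact: cintegrableZ.
  by apply: cintegrableD => //; exact: cintegrableZ.
- move=> x; apply: le_trans (hC x); rewrite cnormM cnorm_real mulrA expr2.
  by rewrite ler_wpM2r ?cnorm_ge0 // ler_wpM2l ?addr_ge0 // lerDr.
Qed.

(* [Re w1 = 0] keeps the decay rate constant along the whole path, which makes it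
   defined for all real times. *)
Section gaussian_path.
Variables (w0 w1 k0 k1 : R[i]).
Hypothesis (Rew0 : 0 < complex.Re w0) (Rew1 : complex.Re w1 = 0).

Let w u := w0 + u%:C * w1.
Let k u := k0 + u%:C * k1.
Let E x := - (w1 / 2) * x%:C ^+ 2 + k1 * x%:C.
Let g u x := cgauss (w u) (k u) x.

Let Rew u : complex.Re (w u) = complex.Re w0.
Proof. by rewrite /w cReD cReM /= Rew1 mulr0 mul0r subr0 addr0. Qed.

Let Rewgt0 u : 0 < complex.Re (w u). Proof. by rewrite Rew. Qed.

Let derg u x : cderive (g ^~ x) u (E x * g u x).
Proof.
rewrite /g /cgauss; apply: cderive_cexp.
have -> : (fun y => - (w y / 2) * x%:C ^+ 2 + k y * x%:C) =
    (fun y => (- (w0 / 2) * x%:C ^+ 2 + k0 * x%:C) + E x * y%:C).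
  by apply/funext => y; rewrite /w /k /E; field.
apply: eq_cderive.
  by apply: cderiveD; [exact: cderive_cst|exact/cderiveZ/cderive_id].
by rewrite add0r mulr1.
Qed.

Let Epoly x : cnorm (E x) <= (cnorm (- (w1 / 2)) + cnorm k1) * (1 + `|x|) ^+ 2.
Proof.
rewrite (le_trans (cnormD _ _)) // mulrDl (cnormM (- _)) (cnormM k1) cnormX cnorm_real.
have x1 : 1 <= 1 + `|x| by rewrite lerDl.
rewrite lerD // ler_wpM2l ?cnorm_ge0 //.
  by rewrite lerXn2r ?nnegrE ?addr_ge0 // lerDr.
by rewrite (@le_trans _ _ (1 + `|x|)) ?lerDr // ler_eXnr.
Qed.

Let mE : cmeas (E : measurableTypeR R -> R[i]).
Proof.
by apply: cmeasD; apply: cmeasM; try exact: cmeas_cst;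
   [exact/cmeasX/cmeas_id|exact: cmeas_id].
Qed.

(** For [v] within 1 of [u] the linear coefficient is bounded by [K] and the decay rate does not
    move. [expR_sqr_bound] then absorbs the quadratic factor [E] and the linear exponent at the
    price of half the rate. *)
Let dominating u : exists2 G : R -> R, mu.-integrable setT (EFin \o G) &
  (forall x, 0 <= G x) /\
  forall v x, v \in `]u - 1, u + 1[ -> cnorm (E x * g v x) <= G x.
Proof.
pose K := cnorm k0 + (`|u| + 1) * cnorm k1.
pose A := cnorm (- (w1 / 2)) + cnorm k1.
have A0 : 0 <= A by rewrite addr_ge0 ?cnorm_ge0.
have a0 : 0 < complex.Re w0 / 2 by rewrite divr_gt0.
have [C C0 hC] := expR_sqr_bound K 2 a0.
exists (fun x => A * C * expR (- (complex.Re w0 / 2 / 2) * x ^+ 2)).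
  by apply: integrable_scale; apply: (integral_expR_sqr _).1; rewrite !divr_gt0.
split => [x|v x]; first by rewrite !mulr_ge0 ?expR_ge0 // ltW.
rewrite in_itv /= => /andP[uv vu].
rewrite cnormM (le_trans (ler_pM (cnorm_ge0 _) (cnorm_ge0 _) (Epoly x) (cnorm_cgauss_le _ _ _))) //.
rewrite -/A -[leLHS]mulrA -[leRHS]mulrA ler_wpM2l // -[x ^+ 2]real_normK ?num_real //.
apply: le_trans (hC _ (normr_ge0 x)).
rewrite ler_wpM2l ?exprn_ge0 ?addr_ge0 // ler_expR Rew lerD2l ler_wpM2r //.
rewrite /k (le_trans (cnormD _ _)) // lerD2l cnormM cnorm_real ler_wpM2r ?cnorm_ge0 //.
have h : `|v - u| <= 1 by rewrite ler_norml; apply/andP; split; lra.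
by rewrite -(subrK u v) addrC (le_trans (ler_normD _ _)) // lerD2l.
Qed.

Lemma cderive_gaussian_path u :
  cderive (fun u => cint mu (g u)) u (cint mu (fun x => E x * g u x)).
Proof.
have [G iG [G0 hG]] := dominating u.
have uI : `]u - 1, u + 1[%classic u by rewrite /= in_itv /= gtrBl ltrDl ltr01.
have gi v : cintegrable mu (g v) by exact: cintegrable_cgauss.
have d1 v x : (fun y => complex.Re (g y x))^`()%classic v = complex.Re (E x * g v x).
  by rewrite derive1E; have [[_ ->]] := derg v x.
have d2 v x : (fun y => complex.Im (g y x))^`()%classic v = complex.Im (E x * g v x).
  by rewrite derive1E; have [_ [_ ->]] := derg v x.
split.
  have D := @derivable_under_integral R _ _ mu (fun v x => complex.Re (g v x)) setT
    measurableT u (u - 1) (u + 1) uI (fun v _ => (gi v).1) _ G G0 iG _.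
  have D' := @differentiation_under_integral R _ _ mu (fun v x => complex.Re (g v x)) setT
    measurableT u (u - 1) (u + 1) uI (fun v _ => (gi v).1) _ G G0 iG _.
  have H1 : forall (x : R) y, `]u - 1, u + 1[%classic x -> [set: measurableTypeR R] y ->
     derivable ((fun v x => complex.Re (g v x))^~ y) x 1.
    by move=> v x _ _; have [[]] := derg v x.
  have H2 : forall v x, `]u - 1, u + 1[%classic v -> [set: measurableTypeR R] x ->
      `|partial1of2 (fun v x => complex.Re (g v x)) v x| <= G x.
    move=> v x vI _; rewrite /partial1of2 d1 (le_trans (Re_le_cnorm _)) //.
    exact: hG.
  apply: DeriveDef; first exact: D.
  rewrite -derive1E; apply: etrans (D' H1 H2) _.
  by apply: eq_Rintegral => x _; rewrite /partial1of2 d1.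
have D := @derivable_under_integral R _ _ mu (fun v x => complex.Im (g v x)) setT
  measurableT u (u - 1) (u + 1) uI (fun v _ => (gi v).2) _ G G0 iG _.
have D' := @differentiation_under_integral R _ _ mu (fun v x => complex.Im (g v x)) setT
  measurableT u (u - 1) (u + 1) uI (fun v _ => (gi v).2) _ G G0 iG _.
have H1 : forall (x : R) y, `]u - 1, u + 1[%classic x -> [set: measurableTypeR R] y ->
   derivable ((fun v x => complex.Im (g v x))^~ y) x 1.
  by move=> v x _ _; have [_ []] := derg v x.
have H2 : forall v x, `]u - 1, u + 1[%classic v -> [set: measurableTypeR R] x ->
    `|partial1of2 (fun v x => complex.Im (g v x)) v x| <= G x.
  move=> v x vI _; rewrite /partial1of2 d2 (le_trans (Im_le_cnorm _)) //.
  exact: hG.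
apply: DeriveDef; first exact: D.
rewrite -derive1E; apply: etrans (D' H1 H2) _.
by apply: eq_Rintegral => x _; rewrite /partial1of2 d2.
Qed.

End gaussian_path.

End complex_gaussian.

Section gaussian_fourier.
Context {R : realType}.
Notation mu := (@lebesgue_measure R).
Implicit Types (w k : R[i]).

(* Along [u |-> u k], the moment identity is a linear ODE for the integral. *)
Lemma gaussian_linear w k : 0 < complex.Re w ->
  cint mu (cgauss w k) = cint mu (cgauss w 0) * cexp (k ^+ 2 / (2 * w)).
Proof.
move=> w0; have wn0 := Re_gt0_neq0 w0.
pose F u := cint mu (cgauss (w + u%:C * 0) (0 + u%:C * k)).
have FE u : F u = cint mu (cgauss w (u%:C * k)) by rewrite /F mulr0 addr0 add0r.
(* By [gaussian_moment1], [F' = (u * k ^+ 2 / w) * F]; the exponential is the integrating factor. *)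
pose H u := F u * cexp (- (k ^+ 2 / (2 * w)) * u%:C ^+ 2).
have dH u : cderive H u 0.
  have d1 := @cderive_gaussian_path R w 0 0 k w0 erefl u.
  have d2 := cderiveM d1 (cderive_cexp
    (cderiveZ (- (k ^+ 2 / (2 * w))) (cderive_sqr (cderive_id u)))).
  apply: (eq_cderive d2).
  have E : cint mu (fun x => (- (0 / 2) * x%:C ^+ 2 + k * x%:C) *
      cgauss (w + u%:C * 0) (0 + u%:C * k) x) =
      k * cint mu (fun x => x%:C * cgauss w (u%:C * k) x).
    rewrite -cintZ; last exact: cintegrable_x_cgauss.
    by apply: eq_cint => x; rewrite mulr0 addr0 add0r mul0r oppr0 mul0r add0r mulrA.
  have M := gaussian_moment1 (u%:C * k) w0.
  rewrite E -/(F u) FE.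
  set m1 := cint mu (fun x => x%:C * _) in M *; set m0 := cint mu _ in M *.
  have -> : m1 = u%:C * k * m0 / w by rewrite -M mulrC mulKf.
  by field.
have := cderive0_cst 1 0 dH.
rewrite /H !FE expr0n expr1n !mulr0 mul0r cexp0 mulr1 mul1r => <-.
by rewrite mulr1 -mulrA -cexpD addNr cexp0 mulr1.
Qed.

(* Squaring avoids the choice of a branch of the square root of [w]. *)
Lemma gaussian_sqr w : 0 < complex.Re w ->
  cint mu (cgauss w 0) ^+ 2 = (2 * pi)%:C / w.
Proof.
case: w => a b /= a0; set w := a +i* b.
have aw u : 0 < complex.Re (a%:C + u%:C * (0 +i* b)).
  by rewrite cReD cReM /= mulr0 mul0r subr0 addr0.
pose F u := cint mu (cgauss (a%:C + u%:C * (0 +i* b)) (0 + u%:C * 0)).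
(* The path is vertical, from [a] at [u = 0] to [w] at [u = 1]. With [v] the current point,
   [gaussian_moment2] gives [F' = - (i b / (2 v)) F], so [F ^+ 2 * v] is conserved and its value is
   read off at the real Gaussian. *)
pose H u := F u ^+ 2 * (a%:C + u%:C * (0 +i* b)).
have dH u : cderive H u 0.
  have d1 := @cderive_gaussian_path R a%:C (0 +i* b) 0 0 a0 erefl u.
  have d2 := cderiveM (cderive_sqr d1)
    (cderiveD (cderive_cst a%:C u) (cderiveM (cderive_id u) (cderive_cst (0 +i* b) u))).
  apply: (eq_cderive d2); rewrite -/(F u).
  set v := a%:C + u%:C * (0 +i* b); have vn0 : v != 0 := Re_gt0_neq0 (aw u).
  have M := gaussian_moment2 0 (aw u); rewrite -/v mul0r addr0 in M.
  have FE : F u = cint mu (cgauss v 0) by rewrite /F mulr0 addr0.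
  have -> : cint mu (fun x => (- ((0 +i* b) / 2) * x%:C ^+ 2 + 0 * x%:C) *
      cgauss v (0 + u%:C * 0) x) =
      - ((0 +i* b) / 2) * cint mu (fun x => x%:C ^+ 2 * cgauss v 0 x).
    rewrite -cintZ; last exact: cintegrable_x2_cgauss (aw u).
    by apply: eq_cint => x; rewrite mulr0 addr0 mul0r addr0 mulrA.
  set m2 := cint mu (fun x => x%:C ^+ 2 * _) in M *.
  have -> : m2 = F u / v by rewrite FE -M mulrC mulKf.
  by field.
have := cderive0_cst 1 0 dH; rewrite /H /F.
have -> : a%:C + 1%:C * (0 +i* b) = w by apply: complexP => /=; ring.
have -> : a%:C + 0%:C * (0 +i* b) = a%:C by rewrite mul0r addr0.
rewrite !mulr0 !addr0 => E.
have wn0 : w != 0 by apply: (@Re_gt0_neq0 _ w).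
apply: (canRL (mulfK wn0)); rewrite E.
have -> : cint mu (cgauss a%:C 0) = (Num.sqrt (pi / (a / 2)))%:C.
  rewrite -(integral_expR_sqr (divr_gt0 a0 (ltr0Sn R 1))).2.
  have cg x : cgauss a%:C 0 x = (expR (- (a / 2) * x ^+ 2))%:C.
    rewrite /cgauss mul0r addr0 (_ : - _ * _ = (- (a / 2) * x ^+ 2)%:C).
      by apply: complexP; rewrite ?Re_cexp ?Im_cexp /= ?cos0 ?sin0 ?mulr1 ?mulr0.
    by rewrite rmorphM rmorphXn rmorphN rmorphM /= fmorphV rmorphD rmorph1.
  by rewrite (funext cg) /cint /= [X in _ +i* X]/Rintegral integral0.
rewrite -rmorphXn -rmorphM /= sqr_sqrtr; last first.
  by rewrite divr_ge0 ?pi_ge0 // ltW // divr_gt0.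
by congr (_%:C); field; rewrite gt_eqF.
Qed.

End gaussian_fourier.

(** * Product integrals on R^n *)

Section product_integral.
Context {R : realType} d1 d2 (T1 : measurableType d1) (T2 : measurableType d2).
Variables (m1 : {sigma_finite_measure set T1 -> \bar R})
          (m2 : {sigma_finite_measure set T2 -> \bar R}).

Lemma integrable_prod (a : T1 -> R) (b : T2 -> R) :
  m1.-integrable setT (EFin \o a) -> m2.-integrable setT (EFin \o b) ->
  (m1 \x m2)%E.-integrable setT (fun z => (a z.1 * b z.2)%:E) /\
  (\int[m1 \x m2]_z (a z.1 * b z.2)%:E)%E =
    ((\int[m1]_x a x)%R * (\int[m2]_x b x)%R)%:E.
Proof.
move=> ia ib.
have ma : measurable_fun setT a by apply/measurable_EFinP; exact: measurable_int ia.
have mb : measurable_fun setT b by apply/measurable_EFinP; exact: measurable_int ib.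
have mab : measurable_fun setT (fun z : T1 * T2 => (a z.1 * b z.2)%:E).
  apply/measurable_EFinP; apply: measurable_funM.
    exact: (measurableT_comp ma measurable_fst).
  exact: (measurableT_comp mb measurable_snd).
have iab : (m1 \x m2)%E.-integrable setT (fun z => (a z.1 * b z.2)%:E).
  apply/(integrable12ltyP _ _ mab).
  under eq_integral => x _.
    under eq_integral => y _ do rewrite /= normrM EFinM.
    rewrite ge0_integralZl_EFin //; last exact/measurable_EFinP/measurableT_comp.
    over.
  rewrite ge0_integralZr //; last 2 first.
  - exact/measurable_EFinP/measurableT_comp.
  - exact: integral_ge0.
  by apply: lte_mul_pinfty; [exact: integral_ge0|
    apply: integrable_fin_num => //; exact: integrable_norm|
    case/integrableP : ib].
split => //; rewrite -(integral12_prod_meas1 iab) /fubini_F /=.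
under eq_integral => x _.
  under eq_integral => y _ do rewrite EFinM.
  rewrite integralZl //.
  over.
rewrite /Rintegral EFinM.
rewrite !fineK; [|exact: integrable_fin_num|exact: integrable_fin_num].
have fb : (\int[m2]_y (b y)%:E)%E \is a fin_num by exact: integrable_fin_num.
rewrite -(fineK fb).
by rewrite integralZr.
Qed.

Lemma cintegrable_prod (f : T1 -> R[i]) (g : T2 -> R[i]) :
  cintegrable m1 f -> cintegrable m2 g ->
  cintegrable (m1 \x m2)%E (fun z => f z.1 * g z.2) /\
  cint (m1 \x m2)%E (fun z => f z.1 * g z.2) = cint m1 f * cint m2 g.
Proof.
move=> [f1 f2] [g1 g2].
have [A EA] := integrable_prod f1 g1; have [B EB] := integrable_prod f2 g2.
have [C EC] := integrable_prod f1 g2; have [D ED] := integrable_prod f2 g1.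
split.
  split.
    by under eq_fun do rewrite cReM EFinB; exact: integrableB.
  by under eq_fun do rewrite cImM EFinD; exact: integrableD.
apply: complexP; rewrite cReImE /=.
  under [LHS]eq_Rintegral do rewrite cReM.
  by rewrite RintegralB // {1 2}/Rintegral EA EB.
under [LHS]eq_Rintegral do rewrite cImM.
by rewrite RintegralD // {1 2}/Rintegral EC ED.
Qed.

End product_integral.

Section euclidean_product.
Context {R : realType}.
Notation mu := (@lebesgue_measure R).

Lemma integral_leb_cons n (h : 'rV[R]_n.+1 -> \bar R) :
  measurable_fun setT h ->
  (mu \x leb n)%E.-integrable setT (h \o @rV_cons R n) ->
  (leb n.+1).-integrable setT h /\
  (\int[leb n.+1]_x h x = \int[mu \x leb n]_z (h \o @rV_cons R n) z)%E.
Proof.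
move=> mh ih.
have mc := @measurable_rV_cons R n.
have E (g : 'rV[R]_n.+1 -> \bar R) :
  (\int[leb n.+1]_x g x = \int[pushforward (mu \x leb n)%E (@rV_cons R n)]_x g x)%E.
  by apply: eq_measure_integral.
split.
  apply/integrableP; split => //; rewrite E.
  by have /integrableP[] := integrable_pushforward mc mh ih measurableT.
by rewrite E integral_pushforward.
Qed.

Lemma integral_leb0 (h : 'rV[R]_0 -> \bar R) : (\int[leb 0]_x h x)%E = h 0.
Proof.
rewrite /= integral_dirac ?diracT ?mul1e //.
move=> _ Y _; rewrite setTI.
have [Y0|nY0] := pselect (Y (h 0)).
  rewrite (_ : _ @^-1` _ = setT); first exact: measurableT.
  by rewrite -subTset => x _ /=; rewrite [x](_ : _ = 0) //; apply/rowP => -[].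
rewrite (_ : _ @^-1` _ = set0); first exact: measurable0.
by rewrite -subset0 => x /=; rewrite [x](_ : _ = 0) //; apply/rowP => -[].
Qed.

(** Pulses and waves on [R^n] factor over the coordinates, so this reduces their integrals to the
    line. *)
Lemma cint_leb_prod n (f : 'I_n -> R -> R[i]) :
  (forall i, cintegrable mu (f i)) ->
  cintegrable (leb n) (fun x : 'rV[R]_n => \prod_i f i (x ord0 i)) /\
  cint (leb n) (fun x : 'rV[R]_n => \prod_i f i (x ord0 i)) = \prod_i cint mu (f i).
Proof.
elim: n f => [|n IH] f fi.
  have E (c : R) : (leb 0).-integrable setT (cst c%:E : 'rV[R]_0 -> _).
    apply/integrableP; split; first exact: measurable_cst.
    by rewrite integral_leb0 /= ltry.
  split; last by rewrite big_ord0 /cint /Rintegral !integral_leb0 !big_ord0.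
  by split; under eq_fun do rewrite big_ord0; exact: E.
pose g (x : 'rV[R]_n) := \prod_(i < n) f (lift ord0 i) (x ord0 i).
have [gi gE] := IH (fun i => f (lift ord0 i)) (fun i => fi _).
have [P PE] := cintegrable_prod (fi ord0) gi.
pose h (x : 'rV[R]_n.+1) := \prod_i f i (x ord0 i).
have hE z : h (rV_cons z) = f ord0 z.1 * g z.2.
  rewrite /h big_ord_recl /rV_cons; congr (f _ _ * _).
    rewrite (_ : ord0 = lshift n (ord0 : 'I_1)); last exact/val_inj.
    by rewrite (@row_mxEl R 1 1 n) mxE eqxx.
  apply: eq_bigr => i _; congr (f _ _).
  rewrite (_ : lift ord0 i = rshift 1 i); last exact/val_inj.
  by rewrite (@row_mxEr R 1 1 n).
have mh : cmeas h.
  apply: cmeas_prod => i.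
  exact: (cmeas_comp (cintegrable_meas (fi i)) (measurable_coord_rV i)).
have mh1 : measurable_fun setT (fun x => (complex.Re (h x))%:E).
  by apply/measurable_EFinP; case: mh.
have mh2 : measurable_fun setT (fun x => (complex.Im (h x))%:E).
  by apply/measurable_EFinP; case: mh.
have h1 : (mu \x leb n)%E.-integrable setT ((fun x => (complex.Re (h x))%:E) \o @rV_cons R n).
  by rewrite /comp; under eq_fun do rewrite hE; case: P.
have h2 : (mu \x leb n)%E.-integrable setT ((fun x => (complex.Im (h x))%:E) \o @rV_cons R n).
  by rewrite /comp; under eq_fun do rewrite hE; case: P.
have [I1 E1] := integral_leb_cons mh1 h1; have [I2 E2] := integral_leb_cons mh2 h2.
split; first by split.
rewrite big_ord_recl -gE -PE; apply: complexP; rewrite /= /Rintegral -/h.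
  by rewrite E1; congr fine; apply: eq_integral => z _ /=; rewrite hE.
by rewrite E2; congr fine; apply: eq_integral => z _ /=; rewrite hE.
Qed.

End euclidean_product.

(** * Fourier transforms of translated Gaussians *)

Section gaussian_waves.
Context {R : realType}.
Notation mu := (@lebesgue_measure R).
Implicit Types (z : R[i]) (b x s : R).

(** One of the square roots of [2 * pi / w], by [gaussian_sqr]. Which one is never determined: on
    [R^(n + n)] only even powers are evaluated, and on the diagonal only the modulus matters. *)
Definition gauss_int (w : R[i]) : R[i] := cint mu (cgauss w 0).

(** The complex width [z] sits in the denominator so that it becomes the coefficient of the
    quadratic exponent on the Fourier side, where the Schroedinger phase adds to it. *)
Definition pulse z b x : R[i] := cexp (- ((x - b)%:C ^+ 2 / (2 * z))).

Lemma cis_pulse z b s x : z != 0 ->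
  cis (x * s) * pulse z b x =
  cexp (- (b%:C ^+ 2 / (2 * z))) * cgauss z^-1 (b%:C / z + (0 +i* s)) x.
Proof.
move=> z0; rewrite cis_cexp /pulse /cgauss -!cexpD; congr cexp.
have -> : 0 +i* (x * s) = (0 +i* s) * x%:C :> R[i] by apply: complexP => /=; ring.
by rewrite rmorphB /=; field.
Qed.

Lemma Im_real_sqr s : (0 +i* s) ^+ 2 = - (s%:C ^+ 2) :> R[i].
Proof. by apply: complexP; rewrite expr2 /=; ring. Qed.

Lemma cintegrable_cis_pulse z b s : 0 < complex.Re z ->
  cintegrable mu (fun x => cis (x * s) * pulse z b x).
Proof.
move=> z0; under eq_fun do rewrite (cis_pulse _ _ _ (Re_gt0_neq0 z0)).
by apply/cintegrableZ/cintegrable_cgauss/cReV_gt0.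
Qed.

(** [gaussian_linear] at the complex coefficient [b / z + i s] takes the place of a contour shift.
    The frequency is [- s], so that the same lemma serves the convention of [fourier] after a change
    of sign. *)
Lemma fourier_pulse z b s : 0 < complex.Re z ->
  cint mu (fun x => cis (x * s) * pulse z b x) =
  gauss_int z^-1 * cgauss z (0 +i* b) s.
Proof.
move=> z0; have zn0 := Re_gt0_neq0 z0; have zV0 := cReV_gt0 z0.
under eq_fun do rewrite (cis_pulse _ _ _ zn0).
rewrite cintZ; last exact: cintegrable_cgauss.
rewrite (gaussian_linear _ zV0) mulrCA -/(gauss_int _); congr (_ * _).
rewrite -cexpD /cgauss; congr cexp.
have -> : 0 +i* b = (0 +i* 1) * b%:C by apply: complexP => /=; ring.
have -> : 0 +i* s = (0 +i* 1) * s%:C by apply: complexP => /=; ring.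
have := Im_real_sqr 1; set i := 0 +i* 1 => i2.
transitivity (b%:C * s%:C * i + z * s%:C ^+ 2 / 2 * i ^+ 2); first by field.
by rewrite i2; field.
Qed.

Lemma cis_cgauss z b s x :
  cis (x * s) * cgauss z (0 +i* - b) s = cgauss z (0 +i* (x - b)) s.
Proof.
rewrite cis_cexp /cgauss -cexpD; congr cexp.
have -> : 0 +i* (x * s) = (0 +i* x) * s%:C :> R[i] by apply: complexP => /=; ring.
rewrite addrCA -mulrDl; congr (_ + _ * _).
by apply: complexP => /=; ring.
Qed.

Lemma cint_wave z b x : 0 < complex.Re z ->
  cint mu (fun s => cgauss z (0 +i* (x - b)) s) = gauss_int z * pulse z b x.
Proof.
move=> z0; rewrite (gaussian_linear _ z0) /pulse Im_real_sqr; congr (_ * cexp _).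
by field; exact: Re_gt0_neq0.
Qed.

(** This is why the flow is a shift of the parameter [z]: the phase of the propagator is itself a
    quadratic exponent, with imaginary coefficient. *)
Lemma cis_shift z k t s :
  cis (- (t * s ^+ 2 / 2)) * cgauss z k s = cgauss (z + (0 +i* t)) k s.
Proof.
rewrite cis_cexp /cgauss -cexpD; congr cexp.
have -> : 0 +i* - (t * s ^+ 2 / 2) = - ((0 +i* t) / 2) * s%:C ^+ 2 :> R[i].
  rewrite -[2 in RHS]/((1 + 1) +i* (0 + 0)).
  by apply: complexP; rewrite expr2 /=; field.
by field.
Qed.

End gaussian_waves.

Section euclidean.
Context {R : realType}.
Notation mu := (@lebesgue_measure R).

Lemma enorm_sqr n (x : 'rV[R]_n) : enorm x ^+ 2 = \sum_i x ord0 i ^+ 2.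
Proof.
rewrite sqr_sqrtr; first by apply: eq_bigr => i _; rewrite expr2.
by apply: sumr_ge0 => i _; rewrite -expr2 sqr_ge0.
Qed.

Lemma enorm_ge0 n (x : 'rV[R]_n) : 0 <= enorm x.
Proof. exact: sqrtr_ge0. Qed.

Lemma measurable_enorm n : measurable_fun setT (@enorm R n).
Proof.
have ms : measurable_fun setT (@Num.sqrt R).
  by apply: continuous_measurable_fun; exact: sqrt_continuous.
apply: (measurableT_comp ms).
by apply: measurable_sum => i; apply: measurable_funM; exact: measurable_coord_rV.
Qed.

Lemma measurable_dotv n (x : 'rV[R]_n) : measurable_fun setT (dotv x).
Proof.
apply: measurable_sum => i; apply: measurable_funM => //.
exact: measurable_coord_rV.
Qed.

Lemma dotvC n (x y : 'rV[R]_n) : dotv x y = dotv y x.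
Proof. by apply: eq_bigr => i _; rewrite mulrC. Qed.

Lemma cis_sum I (r : seq I) (P : pred I) (F : I -> R) :
  cis (\sum_(i <- r | P i) F i) = \prod_(i <- r | P i) cis (F i).
Proof.
apply: (big_morph cis) => [a b|]; last by rewrite cis_cexp; exact: cexp0.
by rewrite !cis_cexp -cexpD; congr cexp; apply: complexP; rewrite /= ?addr0.
Qed.

Lemma cmeas_cis d (T : measurableType d) (f : T -> R) :
  measurable_fun setT f -> cmeas (fun x => cis (f x)).
Proof.
move=> mf; under eq_fun do rewrite cis_cexp.
by apply: cmeas_cexp; split => //=; exact: measurable_cst.
Qed.

Lemma cintegrable_cis d (T : measurableType d) (m : {measure set T -> \bar R})
    (f : T -> R) (g : T -> R[i]) :
  measurable_fun setT f -> cintegrable m g -> cintegrable m (fun x => cis (f x) * g x).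
Proof.
move=> mf ig; apply: (cintegrable_le _ (cintegrable_norm ig)).
  by apply: cmeasM; [exact: cmeas_cis|exact: cintegrable_meas ig].
by move=> x; rewrite cnormM cnorm_cis mul1r.
Qed.

Lemma cintegralE n (f : 'rV[R]_n -> R[i]) : cintegral f = cint (leb n) f.
Proof. by []. Qed.

Lemma fourier_sum n (I : finType) (c : I -> R[i]) (f : I -> 'rV[R]_n -> R[i]) xi :
  (forall j, cintegrable (leb n) (f j)) ->
  fourier (fun x => \sum_j c j * f j x) xi = \sum_j c j * fourier (f j) xi.
Proof.
move=> fi.
have ci j : cintegrable (leb n) (fun x => cis (- dotv x xi) * f j x).
  apply: cintegrable_cis => //; apply: measurable_funN.
  by under eq_fun do rewrite dotvC; exact: measurable_dotv.
rewrite /fourier cintegralE.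
rewrite (_ : (fun x => _) = (fun x => \sum_j c j * (cis (- dotv x xi) * f j x))).
  rewrite cint_sum => [|j]; last exact: cintegrableZ.
  by apply: eq_bigr => j _; rewrite cintZ.
by apply/funext => x; rewrite mulr_sumr; apply: eq_bigr => j _; rewrite mulrCA.
Qed.

Lemma inv_fourier_sum n (I : finType) (c : I -> R[i]) (f : I -> 'rV[R]_n -> R[i]) x :
  (forall j, cintegrable (leb n) (f j)) ->
  inv_fourier (fun xi => \sum_j c j * f j xi) x = \sum_j c j * inv_fourier (f j) x.
Proof.
move=> fi.
have ci j : cintegrable (leb n) (fun xi => cis (dotv x xi) * f j xi).
  by apply: cintegrable_cis => //; exact: measurable_dotv.
rewrite /inv_fourier !cintegralE.
rewrite [X in _ * cint _ X = _](_ : _ =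
  (fun xi => \sum_j c j * (cis (dotv x xi) * f j xi))).
  rewrite cint_sum => [|j]; last exact: cintegrableZ.
  rewrite mulr_sumr; apply: eq_bigr => j _.
  by rewrite cintZ // cintegralE mulrCA.
by apply/funext => y; rewrite mulr_sumr; apply: eq_bigr => j _; rewrite mulrCA.
Qed.

Definition mpulse n z (b x : 'rV[R]_n) : R[i] :=
  \prod_i pulse z (b ord0 i) (x ord0 i).

(** The Fourier transform of [mpulse z b] up to a constant. Translation by [b] and the imaginary
    part of [z] only affect its phase. *)
Definition mwave n (z : R[i]) (b xi : 'rV[R]_n) : R[i] :=
  \prod_i cgauss z (0 +i* - b ord0 i) (xi ord0 i).

Lemma cintegrable_mpulse n z (b : 'rV[R]_n) : 0 < complex.Re z ->
  cintegrable (leb n) (mpulse z b).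
Proof.
move=> z0; apply: (cint_leb_prod (f := fun i => pulse z (b ord0 i)) _).1 => i.
have := cintegrable_cis_pulse (b ord0 i) 0 z0.
under [X in cintegrable _ X -> _]eq_fun do rewrite mulr0 cis_cexp cexp0 mul1r.
by [].
Qed.

Lemma cintegrable_mwave n z (b : 'rV[R]_n) : 0 < complex.Re z ->
  cintegrable (leb n) (mwave z b).
Proof.
move=> z0; apply: (cint_leb_prod (f := fun i => cgauss z (0 +i* - b ord0 i)) _).1 => i.
exact: cintegrable_cgauss.
Qed.

Lemma fourier_mpulse n z (b xi : 'rV[R]_n) : 0 < complex.Re z ->
  fourier (mpulse z b) xi = gauss_int z^-1 ^+ n * mwave z b xi.
Proof.
move=> z0; rewrite /fourier cintegralE.
pose f (i : 'I_n) x := cis (x * - xi ord0 i) * pulse z (b ord0 i) x.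
rewrite (_ : (fun x => _) = (fun x : 'rV[R]_n => \prod_i f i (x ord0 i))).
  rewrite (cint_leb_prod _).2 => [|i]; last exact: cintegrable_cis_pulse.
  under eq_bigr do rewrite fourier_pulse //.
  rewrite big_split /= prodr_const card_ord; congr (_ * _).
  apply: eq_bigr => i _; rewrite /cgauss rmorphN /= sqrrN.
  by rewrite (_ : (0 +i* b ord0 i) * _ = (0 +i* - b ord0 i) * (xi ord0 i)%:C) //;
     apply: complexP => /=; ring.
apply/funext => x; rewrite /dotv -sumrN cis_sum -big_split.
by apply: eq_bigr => i _; rewrite /f mulrN.
Qed.

Lemma cint_mwave n z (b x : 'rV[R]_n) : 0 < complex.Re z ->
  cint (leb n) (fun xi => cis (dotv x xi) * mwave z b xi) =
  gauss_int z ^+ n * mpulse z b x.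
Proof.
move=> z0; pose f (i : 'I_n) := cgauss z (0 +i* (x ord0 i - b ord0 i)).
rewrite (_ : (fun x => _) = (fun xi : 'rV[R]_n => \prod_i f i (xi ord0 i))).
  rewrite (cint_leb_prod _).2 => [|i]; last exact: cintegrable_cgauss.
  under eq_bigr do rewrite cint_wave //.
  by rewrite big_split /= prodr_const card_ord.
apply/funext => xi; rewrite /dotv cis_sum -big_split.
by apply: eq_bigr => i _; rewrite /= cis_cgauss.
Qed.

Lemma enorm_row_mx n (zeta : 'rV[R]_(n + n)) :
  enorm (lsubmx zeta) ^+ 2 + enorm (rsubmx zeta) ^+ 2 = \sum_i zeta ord0 i ^+ 2.
Proof.
rewrite !enorm_sqr big_split_ord /=.
by congr (_ + _); apply: eq_bigr => i _; rewrite mxE.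
Qed.

Lemma cis_mwave n t z (b xi : 'rV[R]_n) :
  cis (- (t * (\sum_i xi ord0 i ^+ 2) / 2)) * mwave z b xi =
  mwave (z + (0 +i* t)) b xi.
Proof.
rewrite mulr_sumr mulr_suml -sumrN cis_sum -big_split.
by apply: eq_bigr => i _ /=; rewrite cis_shift.
Qed.

End euclidean.

(** * Boxes and Gaussian weights on [R^n] *)

Section boxes.
Context {R : realType}.
Notation mu := (@lebesgue_measure R).

Lemma integral_leb_prod n (f : 'I_n -> R -> R) :
  (forall i, mu.-integrable setT (EFin \o f i)) ->
  (leb n).-integrable setT (fun x => (\prod_i f i (x ord0 i))%:E) /\
  (\int[leb n]_x \prod_i f i (x ord0 i))%R = \prod_i (\int[mu]_x f i x)%R.
Proof.
move=> fi; pose g (i : 'I_n) (x : R) : R[i] := (f i x)%:C.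
have gi i : cintegrable mu (g i).
  by split; [exact: fi|exact: (cintegrable0 mu).1].
have [[I _] E] := cint_leb_prod gi.
have gE (x : 'rV[R]_n) : \prod_i g i (x ord0 i) = (\prod_i f i (x ord0 i))%:C.
  by rewrite rmorph_prod.
split; first by move: I; under eq_fun do rewrite gE.
have := congr1 (@complex.Re R) E; rewrite /cint /=.
under [in LHS]eq_Rintegral do rewrite gE.
move=> -> /=; rewrite (_ : \prod_i _ = (\prod_i (\int[mu]_x f i x)%R)%:C) //.
rewrite rmorph_prod; apply: eq_bigr => i _; apply: complexP => //=.
by rewrite /Rintegral integral0.
Qed.

Definition box n (b c : 'rV[R]_n) : set 'rV[R]_n :=
  [set x | forall i, b ord0 i <= x ord0 i <= c ord0 i].

Lemma indic_box n (b c x : 'rV[R]_n) :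
  \1_(box b c) x = \prod_i (\1_(`[b ord0 i, c ord0 i]%classic) (x ord0 i) : R).
Proof.
have [xb|xb] := pselect (box b c x).
  rewrite indicE mem_set //= big1 // => i _.
  by rewrite indicE mem_set //= in_itv /=; exact: xb.
rewrite indicE memNset //=; apply/esym/eqP; rewrite prodf_seq_eq0.
apply/hasP.
have /existsNP[i /negP hi] : ~ forall i, b ord0 i <= x ord0 i <= c ord0 i := xb.
by exists i; rewrite ?mem_index_enum // indicE memNset //= in_itv /=; exact/negP.
Qed.

Lemma measurable_box n (b c : 'rV[R]_n) : measurable (box b c).
Proof.
rewrite (_ : box b c = \bigcap_(i in [set: 'I_n])
    ((fun x : 'rV[R]_n => x ord0 i) @^-1` `[b ord0 i, c ord0 i]%classic)).
  apply: fin_bigcap_measurable => [|i _]; first exact: finite_finset.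
  rewrite -[X in measurable X]setTI;
  by apply: (measurable_coord_rV i measurableT); exact: measurable_itv.
apply/seteqP; split => x /=.
  by move=> xb i _ /=; rewrite in_itv /=; exact: xb.
by move=> xb i; have := xb i I; rewrite /= in_itv.
Qed.

Lemma leb_box n (b c : 'rV[R]_n) : (forall i, b ord0 i <= c ord0 i) ->
  leb n (box b c) = (\prod_i (c ord0 i - b ord0 i))%:E.
Proof.
move=> bc; rewrite -(setIT (box b c)) -integral_indic //; last exact: measurable_box.
pose f (i : 'I_n) : R -> R := \1_(`[b ord0 i, c ord0 i]%classic).
have fi i : mu.-integrable setT (EFin \o f i).
  by apply: integrable_indic_itv.
have [I E] := integral_leb_prod fi.
under eq_integral do rewrite indic_box.
rewrite -[LHS]fineK; last by exact: integrable_fin_num I.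
congr EFin; rewrite -/(Rintegral _ _ _) E; apply: eq_bigr => i _.
rewrite /Rintegral integral_indic //= setIT lebesgue_measure_itv /=.
case: ifPn => //; rewrite lte_fin -leNgt => cb.
by rewrite (le_anti (_ : b ord0 i <= c ord0 i <= b ord0 i)) ?subrr // bc.
Qed.

End boxes.

Section gaussian_weight.
Context {R : realType}.
Notation mu := (@lebesgue_measure R).

Lemma prod_expR n (a : R) (x : 'rV[R]_n) :
  \prod_i expR (- a * x ord0 i ^+ 2) = expR (- a * enorm x ^+ 2).
Proof. by rewrite -expR_sum -mulr_sumr enorm_sqr. Qed.

Lemma integrable_poly_gauss n (a K : R) (m : nat) (g : 'rV[R]_n -> R) : 0 < a ->
  measurable_fun setT g -> (forall x, `|g x| <= K * (1 + enorm x) ^+ m) ->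
  (leb n).-integrable setT (EFin \o (fun x => g x * expR (- a * enorm x ^+ 2))).
Proof.
move=> a0 mg gK; have [C C0 hC] := expR_sqr_bound 0 m a0.
have K0 : 0 <= K.
  have e0 : 0 < (1 + enorm (0 : 'rV[R]_n)) ^+ m.
    by rewrite exprn_gt0 // ltr_pwDl // enorm_ge0.
  by rewrite -(pmulr_lge0 _ e0) (le_trans _ (gK 0)).
have a20 : 0 < a / 2 by rewrite divr_gt0.
have [I _] := @integral_leb_prod R n (fun _ x => expR (- (a / 2) * x ^+ 2))
  (fun _ => (integral_expR_sqr a20).1).
have me : measurable_fun setT (fun x : 'rV[R]_n => expR (- a * enorm x ^+ 2)).
  apply: measurableT_comp => //; apply: measurable_funM => //.
  by apply: measurable_funX; exact: measurable_enorm.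
apply: (@le_integrableT _ _ _ _ _ (fun x => K * C * expR (- (a / 2) * enorm x ^+ 2))).
- exact: measurable_funM.
- apply: integrable_scale; move: I; rewrite /comp.
  by under eq_fun do rewrite prod_expR.
- move=> x; rewrite normrM (ger0_norm (expR_ge0 _)).
  apply: (le_trans (ler_wpM2r (expR_ge0 _) (gK x))).
  rewrite -[leLHS]mulrA -[leRHS]mulrA ler_wpM2l //.
  by have := hC _ (enorm_ge0 x); rewrite mul0r addr0.
Qed.

Lemma measurable_enorm_powR n (alpha : R) :
  measurable_fun setT (fun x : 'rV[R]_n => enorm x `^ alpha).
Proof. exact: (measurableT_comp (measurable_powR alpha) (@measurable_enorm R n)). Qed.

Lemma powR_le_exp (x a : R) : 0 <= x -> 0 <= a ->
  x `^ a <= (1 + x) ^+ (Num.truncn a).+1.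
Proof.
move=> x0 a0; have x1 : 1 <= 1 + x by rewrite lerDl.
apply: (@le_trans _ _ ((1 + x) `^ a)).
  by rewrite ge0_ler_powR // ?nnegrE ?addr_ge0 // lerDr.
rewrite -powR_mulrn ?addr_ge0 // ler_powR //.
exact/ltW/truncnS_gt.
Qed.

Lemma integrable_weight n (a K alpha : R) (m : nat) (g : 'rV[R]_n -> R) :
  0 < a -> 0 <= alpha ->
  measurable_fun setT g -> (forall x, `|g x| <= K * (1 + enorm x) ^+ m) ->
  (leb n).-integrable setT
    (EFin \o (fun x => enorm x `^ alpha * g x * expR (- a * enorm x ^+ 2))).
Proof.
move=> a0 al0 mg gK.
apply: (@integrable_poly_gauss n a K ((Num.truncn alpha).+1 + m)) => //.
  by apply: measurable_funM => //; exact: measurable_enorm_powR.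
move=> x; rewrite normrM ger0_norm ?powR_ge0 // exprD mulrCA.
apply: ler_pM => //; first exact: powR_ge0.
exact: powR_le_exp (enorm_ge0 x) al0.
Qed.

(** On the cube [[1, 2]^n] each exponential factor is at least [expR (- a * 4)], and [enorm x >= 1]
    because there is at least one coordinate. In dimension 0 the power would vanish for positive
    [alpha]. *)
Lemma integral_weight_gt0 n (a alpha : R) : (0 < n)%N -> 0 < a -> 0 <= alpha ->
  0 < (\int[leb n]_x (enorm x `^ alpha * expR (- a * enorm x ^+ 2)))%R.
Proof.
move=> n0 a0 al0.
pose f (_ : 'I_n) (x : R) : R := expR (- a * 4) * \1_(`[1, 2]%classic) x.
have fi i : mu.-integrable setT (EFin \o f i).
  by apply: integrable_scale; exact: integrable_indic_itv.
have [I E] := integral_leb_prod fi.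
apply: (@lt_le_trans _ _ (\int[leb n]_x \prod_i f i (x ord0 i))%R).
  rewrite E; apply: prodr_gt0 => i _; rewrite /f RintegralZl //; last first.
    exact: integrable_indic_itv.
  rewrite mulr_gt0 ?expR_gt0 // /Rintegral integral_indic //= setIT.
  by rewrite lebesgue_measure_itv /= lte_fin ltr1n /=; lra.
apply: le_Rintegral => //.
  have := @integrable_weight n a 1 alpha 0 (fun=> 1) a0 al0 (measurable_cst _).
  rewrite /comp; under eq_fun do rewrite mulr1; apply => x.
  by rewrite normr1 mulr1.
move=> x _; rewrite /f.
have [xb|xb] := pselect (forall i : 'I_n, 1 <= x ord0 i <= 2); last first.
  move/existsNP: xb => [i hi].
  rewrite (bigD1 i) //= indicE memNset ?mulr0 ?mul0r /=; last by rewrite in_itv.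
  by rewrite mulr_ge0 ?powR_ge0 ?expR_ge0.
have e1 : 1 <= enorm x.
  rewrite -[leLHS]ger0_norm // -sqrtr_sqr ler_wsqrtr // expr1n /dotv.
  rewrite (bigD1 (Ordinal n0)) //=.
  apply: (@le_trans _ _ (x ord0 (Ordinal n0) * x ord0 (Ordinal n0))).
    by have /andP[h _] := xb (Ordinal n0); rewrite -expr2 exprn_ege1.
  by rewrite lerDl sumr_ge0 // => i _; rewrite -expr2 sqr_ge0.
rewrite -prod_expR -[leLHS]mul1r; apply: ler_pM => //.
- by apply: prodr_ge0 => i _; rewrite mulr_ge0 ?expR_ge0.
- rewrite -[leLHS](_ : 1 `^ alpha = 1); last by rewrite powR1.
  by rewrite ge0_ler_powR ?nnegrE // enorm_ge0.
- apply: ler_prod => i _; rewrite mulr_ge0 ?expR_ge0 //=.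
  rewrite indicE mem_set /= ?in_itv /= ?xb // mulr1 ler_expR !mulNr lerN2.
  rewrite ler_pM2l // (_ : 4 = 2 ^+ 2); last by rewrite expr2; lra.
  have /andP[h1 h2] := xb i.
  by rewrite lerXn2r // nnegrE // (le_trans _ h1).
Qed.

End gaussian_weight.

(** * Wave packets *)

Section wave_packets.
Context {R : realType}.
Notation mu := (@lebesgue_measure R).
Variable n : nat.
Implicit Types (z : R[i]) (a x xi : 'rV[R]_n).

(* With [z = 1 + i t], this is the free evolution at time [t] of the unit Gaussian
   centred at [(a, a)]. *)
Definition packet z a (v : 'rV[R]_(n + n)) : R[i] :=
  z^-1 ^+ n * mpulse z (row_mx a a) v.

Lemma cintegrable_packet z a : 0 < complex.Re z -> cintegrable (leb (n + n)) (packet z a).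
Proof. by move=> z0; apply/cintegrableZ/cintegrable_mpulse. Qed.

Lemma gauss_int_sqr (w : R[i]) : 0 < complex.Re w ->
  gauss_int w ^+ (n + n) = ((2 * pi)%:C / w) ^+ n.
Proof. by move=> w0; rewrite -gaussian_sqr // -exprM mul2n addnn. Qed.

Lemma fourier_scale m (c : R[i]) (f : 'rV[R]_m -> R[i]) (xi : 'rV[R]_m) :
  cintegrable (leb m) f -> fourier (fun y => c * f y) xi = c * fourier f xi.
Proof.
move=> fi; have := fourier_sum (fun _ : 'I_1 => c) xi (fun _ : 'I_1 => fi).
by rewrite big_ord1 => <-; congr fourier; apply/funext => y; rewrite big_ord1.
Qed.

Lemma fourier_packet z a (zeta : 'rV[R]_(n + n)) : 0 < complex.Re z ->
  fourier (packet z a) zeta = (2 * pi)%:C ^+ n * mwave z (row_mx a a) zeta.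
Proof.
move=> z0; have zn0 := Re_gt0_neq0 z0.
rewrite /packet fourier_scale; last exact: cintegrable_mpulse.
rewrite fourier_mpulse // gauss_int_sqr; last exact: cReV_gt0.
by rewrite mulrA invrK -exprMn mulrCA mulVf // mulr1.
Qed.

Lemma Re_shift z (t : R) : complex.Re (z + (0 +i* t)) = complex.Re z.
Proof. by rewrite cReD /= addr0. Qed.

Lemma pi2_neq0 : (2 * pi)%:C != 0 :> R[i].
Proof.
by apply: (@Re_gt0_neq0 _ (2 * pi)%:C); rewrite /= mulr_gt0 ?pi_gt0.
Qed.

(** The statement is about sums because linearity of a Fourier multiplier needs integrability on
    both sides of the transform, which the Gaussians provide. The factor [(2 * pi) ^- (n + n)]
    splits evenly between the forward constant and [gauss_int_sqr]. *)
Lemma schrodinger_packets (I : finType) (c : I -> R[i]) (z : I -> R[i]) (a : I -> 'rV[R]_n) t :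
  (forall j, 0 < complex.Re (z j)) ->
  schrodinger t (fun v => \sum_j c j * packet (z j) (a j) v) =
  (fun v => \sum_j c j * packet (z j + (0 +i* t)) (a j) v).
Proof.
move=> z0; apply/funext => v; rewrite /schrodinger /fourier_mult.
have zt j : 0 < complex.Re (z j + (0 +i* t)) by rewrite Re_shift.
have -> : (fun zeta => cis (- (t * (enorm (lsubmx zeta) ^+ 2 + enorm (rsubmx zeta) ^+ 2) / 2)) *
      fourier (fun v => \sum_j c j * packet (z j) (a j) v) zeta) =
    (fun zeta => \sum_j (c j * (2 * pi)%:C ^+ n) *
      mwave (z j + (0 +i* t)) (row_mx (a j) (a j)) zeta).
  apply/funext => zeta; rewrite fourier_sum => [|j]; last exact: cintegrable_packet.
  rewrite mulr_sumr; apply: eq_bigr => j _.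
  by rewrite fourier_packet // enorm_row_mx -cis_mwave; ring.
rewrite inv_fourier_sum => [|j]; last exact: cintegrable_mwave.
apply: eq_bigr => j _; rewrite /inv_fourier cintegralE cint_mwave // gauss_int_sqr //.
set p := (2 * pi)%:C; have pn : p ^+ n != 0 by rewrite expf_neq0 // pi2_neq0.
have -> : ((2 * pi) ^- (n + n))%:C = (p ^+ n * p ^+ n)^-1 :> R[i].
  by rewrite fmorphV /= rmorphXn -exprD.
by rewrite /packet exprMn; field.
Qed.

(** On the diagonal the factors in [x] and in [y] coincide; their exponents add, which halves the
    width. *)
Lemma on_diagonal_packet z a : 0 < complex.Re z ->
  on_diagonal (packet z a) = (fun x => z^-1 ^+ n * mpulse (z / 2) a x).
Proof.
move=> z0; have zn0 := Re_gt0_neq0 z0.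
apply/funext => x; rewrite /on_diagonal /packet; congr (_ * _).
rewrite /mpulse big_split_ord /= -big_split; apply: eq_bigr => i _.
rewrite /= !row_mxEl !row_mxEr /pulse -cexpD; congr cexp.
by field.
Qed.

Lemma Re_half z : complex.Re (z / 2) = complex.Re z / 2.
Proof.
have -> : z / 2 = z * (2^-1)%:C by rewrite fmorphV rmorphD rmorph1.
by rewrite cReM /= mulr0 subr0.
Qed.

Definition spectrum (alpha : R) z a xi : R[i] :=
  (enorm xi `^ alpha)%:C * mwave (z / 2) a xi.

(** This is [|nabla|^alpha] of the diagonal of [packet z a], hence the [F_j] of the overview for
    [z = 1 + i (t_j + t)]. The constants are taken out of the Fourier integral so that they can be
    bounded separately. *)
Definition profile (alpha : R) z a x : R[i] :=
  z^-1 ^+ n * gauss_int (z / 2)^-1 ^+ n * inv_fourier (spectrum alpha z a) x.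

Lemma cnorm_mwave z a xi :
  cnorm (mwave z a xi) = expR (- (complex.Re z / 2) * enorm xi ^+ 2).
Proof.
rewrite -prod_expR /mwave.
rewrite (big_morph _ (fun u v => cnormM u v) (Normc.normc1 _)).
by apply: eq_bigr => i _; rewrite cnorm_cgauss /= mul0r addr0.
Qed.

Lemma cmeas_mwave z a : 0 < complex.Re z -> cmeas (mwave z a).
Proof. by move=> z0; exact: cintegrable_meas (cintegrable_mwave a z0). Qed.

Lemma cintegrable_spectrum alpha z a : 0 <= alpha -> 0 < complex.Re z ->
  cintegrable (leb n) (spectrum alpha z a).
Proof.
move=> al0 z0; have z20 : 0 < complex.Re (z / 2) by rewrite Re_half divr_gt0.
have g1 (x : 'rV[R]_n) : `|1 : R| <= 1 * (1 + enorm x) ^+ 0 by rewrite normr1 mulr1.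
have I := @integrable_weight R n (complex.Re (z / 2) / 2) 1 alpha 0 (fun=> 1)
  (divr_gt0 z20 (ltr0Sn R 1)) al0 (measurable_cst _) g1.
apply: (cintegrable_le _ I).
- apply: cmeasM; last exact: cmeas_mwave.
  by apply: cmeas_real; exact: measurable_enorm_powR.
- by move=> x; rewrite cnormM cnorm_mwave cnorm_real ger0_norm ?powR_ge0 // mulr1.
Qed.

Lemma abs_nabla_packets (alpha : R) (I : finType) (c : I -> R[i]) (z : I -> R[i])
    (a : I -> 'rV[R]_n) x :
  0 <= alpha -> (forall j, 0 < complex.Re (z j)) ->
  abs_nabla alpha (on_diagonal (fun v => \sum_j c j * packet (z j) (a j) v)) x =
  \sum_j c j * profile alpha (z j) (a j) x.
Proof.
move=> al0 z0; rewrite /abs_nabla /fourier_mult.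
have z20 j : 0 < complex.Re (z j / 2) by rewrite Re_half divr_gt0.
have D : on_diagonal (fun v => \sum_j c j * packet (z j) (a j) v) =
    (fun y => \sum_j (c j * (z j)^-1 ^+ n) * mpulse (z j / 2) (a j) y).
  apply/funext => y; apply: eq_bigr => j _.
  by rewrite -mulrA; have /(congr1 (@^~ y)) <- := on_diagonal_packet (a j) (z0 j).
have -> : (fun xi => (enorm xi `^ alpha)%:C *
      fourier (on_diagonal (fun v => \sum_j c j * packet (z j) (a j) v)) xi) =
    (fun xi => \sum_j (c j * (z j)^-1 ^+ n * gauss_int (z j / 2)^-1 ^+ n) *
      spectrum alpha (z j) (a j) xi).
  apply/funext => xi; rewrite D fourier_sum => [|j]; last exact: cintegrable_mpulse.
  rewrite mulr_sumr; apply: eq_bigr => j _; rewrite fourier_mpulse // /spectrum.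
  by rewrite mulrCA -!mulrA; congr (_ * (_ * _)); rewrite mulrCA.
rewrite inv_fourier_sum => [|j]; last exact: cintegrable_spectrum.
by apply: eq_bigr => j _; rewrite /profile -!mulrA.
Qed.

End wave_packets.

(** * Measurability of integrals in a parameter *)

Section parametric_integral.
Context {R : realType}.

(** Tonelli applies to the positive and negative parts, and [fine] of a difference is measurable
    whatever its values; so no integrability in [y] has to be assumed. *)
Lemma measurable_Rintegral_param d1 d2 (T1 : measurableType d1) (T2 : measurableType d2)
    (m : {sigma_finite_measure set T2 -> \bar R}) (f : T1 * T2 -> R) :
  measurable_fun setT f ->
  measurable_fun setT (fun x => (\int[m]_y f (x, y))%R).
Proof.
move=> mf; have me : measurable_fun setT (EFin \o f) by exact/measurable_EFinP.
rewrite (_ : (fun x => _) = fine \o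
    (fun x => \int[m]_y (EFin \o f)^\+ (x, y) - \int[m]_y (EFin \o f)^\- (x, y))%E).
  apply: measurableT_comp; first exact: fine_measurable.
  apply: emeasurable_funB.
    by apply: measurable_fun_fubini_tonelli_F => //; exact: measurable_funepos.
  by apply: measurable_fun_fubini_tonelli_F => //; exact: measurable_funeneg.
apply/funext => x; rewrite /Rintegral integralE /=; congr (fine (_ - _)).
  by apply: eq_integral => y _; rewrite !funeposE.
by apply: eq_integral => y _; rewrite !funenegE.
Qed.

Lemma cmeas_cint_param d1 d2 (T1 : measurableType d1) (T2 : measurableType d2)
    (m : {sigma_finite_measure set T2 -> \bar R}) (f : T1 * T2 -> R[i]) :
  cmeas f -> cmeas (fun x => cint m (fun y => f (x, y))).
Proof.
move=> [f1 f2]; split => /=.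
  exact: (measurable_Rintegral_param m f1).
exact: (measurable_Rintegral_param m f2).
Qed.

Lemma cmeasV d (T : measurableType d) (f : T -> R[i]) : cmeas f -> cmeas (fun x => (f x)^-1).
Proof.
move=> mf; have mV : measurable_fun setT (fun x => (cnorm (f x) ^+ 2)^-1).
  rewrite (_ : (fun x => _) = (fun x => (cnorm (f x) ^+ 2) `^ (-1))).
    exact: (measurableT_comp (measurable_powR _) (measurable_cnorm2 mf)).
  by apply/funext => x; rewrite powR_inv1 // exprn_ge0 // cnorm_ge0.
case: mf => f1 f2; split.
  by under eq_fun do rewrite cReV; exact: measurable_funM.
rewrite (_ : (fun x => _) = (fun x => - complex.Im (f x) * (cnorm (f x) ^+ 2)^-1)).
  by apply: measurable_funM => //; exact: measurable_funN.
by apply/funext => x; rewrite cnorm2; case: (f x) => u v /=; rewrite mulNr.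
Qed.

End parametric_integral.

(** * A lower bound near the centre of a packet *)

Section profile_bounds.
Context {R : realType}.
Notation mu := (@lebesgue_measure R).

Lemma cos_ge_1B (x : R) : 1 - `|x| <= cos x.
Proof.
wlog x0 : x / 0 <= x.
  by move=> h; have [/h //|/ltW x0] := leP 0 x; rewrite -cosN -normrN h // oppr_ge0.
have [c _ E] := @MVT_segment _ (@cos R) (fun x => - sin x) 0 x x0
  (fun y _ => is_derive_cos y) (continuous_subspaceT (@continuous_cos R)).
rewrite cos0 subr0 in E; rewrite -(subrK 1 (cos x)) E addrC lerD2r.
by rewrite ger0_norm // mulNr lerN2 ler_piMl.
Qed.

(** Letting [z] and [x] depend on a common parameter gives joint measurability in time and space,
    hence measurability in time of the integrals over [x]. *)
Lemma cmeas_profile n d (T : measurableType d) (alpha : R) (z : T -> R[i])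
    (a : 'rV[R]_n) (x : T -> 'rV[R]_n) :
  cmeas z -> measurable_fun setT x ->
  cmeas (fun u => profile alpha (z u) a (x u)).
Proof.
move=> mz mx; have mz2 : cmeas (fun u => z u / 2).
  by apply: cmeasM => //; exact: cmeas_cst.
have czg : cmeas (fun u => gauss_int (z u / 2)^-1).
  apply: (@cmeas_cint_param R _ _ T (measurableTypeR R) mu
    (fun p => cgauss (z p.1 / 2)^-1 0 p.2)).
  apply: cmeas_cexp; apply: cmeasD; last first.
    apply: cmeasM; first exact: cmeas_cst.
    exact: (cmeas_comp cmeas_id measurable_snd).
  apply: cmeasM; last exact: (cmeasX 2 (cmeas_comp cmeas_id measurable_snd)).
  apply: cmeasN; apply: cmeasM; last exact: cmeas_cst.
  by apply: cmeasV; exact: (cmeas_comp mz2 measurable_fst).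
apply: cmeasM.
  by apply: cmeasM; apply: cmeasX => //; exact: cmeasV.
rewrite /inv_fourier; apply: cmeasM; first exact: cmeas_cst.
apply: (@cmeas_cint_param R _ _ T _ (leb n)
  (fun p => cis (dotv (x p.1) p.2) * spectrum alpha (z p.1) a p.2)).
have mc i : measurable_fun setT (fun p : T * 'rV[R]_n => p.2 ord0 i).
  exact: (measurableT_comp (measurable_coord_rV i) measurable_snd).
apply: cmeasM.
  apply: cmeas_cis; apply: measurable_sum => i; apply: measurable_funM => //.
  exact: (measurableT_comp (measurableT_comp (measurable_coord_rV i) mx) measurable_fst).
apply: cmeasM.
  apply: cmeas_real.
  exact: (measurableT_comp (@measurable_enorm_powR R n alpha) measurable_snd).
apply: cmeas_prod => i; apply: cmeas_cexp; apply: cmeasD.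
  apply: cmeasM; last by apply: cmeasX; exact: cmeas_real.
  apply: cmeasN; apply: cmeasM; last exact: cmeas_cst.
  exact: (cmeas_comp mz2 measurable_fst).
by apply: cmeasM; [exact: cmeas_cst|exact: cmeas_real].
Qed.

Variables (n : nat) (alpha : R).
Hypotheses (n0 : (0 < n)%N) (al0 : 0 <= alpha).

(** The square of the amplitude is [pi / z], and [cnorm z <= 2 <= pi]. *)
Lemma profile_amplitude (tau : R) : `|tau| <= 1 ->
  1 <= cnorm ((1 +i* tau)^-1 * gauss_int ((1 +i* tau) / 2)^-1).
Proof.
set z := 1 +i* tau => tau1.
have z0 : 0 < complex.Re z by rewrite /= ltr01.
have z20 : 0 < complex.Re (z / 2) by rewrite Re_half divr_gt0.
have zn0 := Re_gt0_neq0 z0.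
have E : (z^-1 * gauss_int (z / 2)^-1) ^+ 2 = pi%:C / z.
  rewrite exprMn /gauss_int gaussian_sqr ?cReV_gt0 // invrK rmorphM rmorphD rmorph1.
  by field.
have nz0 : 0 < cnorm z.
  by rewrite lt_neqAle cnorm_ge0 eq_sym cnorm_eq0 zn0.
have nz2 : cnorm z <= 2.
  have -> : z = 1%:C + (0 +i* tau) by apply: complexP => /=; ring.
  rewrite (le_trans (cnormD _ _)) // cnorm_real normr1 (_ : 2 = 1 + 1 :> R) // lerD2l.
  by rewrite cnormE /= expr0n add0r sqrtr_sqr.
rewrite -(@ler_pXn2r _ 2) ?nnegrE ?cnorm_ge0 // expr1n -cnormX E cnormM cnormV cnorm_real.
rewrite ger0_norm ?pi_ge0 // ler_pdivlMr // mul1r.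
by rewrite (le_trans nz2) // pi_ge2.
Qed.

Lemma cis_spectrum z (a x xi : 'rV[R]_n) :
  cis (dotv x xi) * spectrum alpha z a xi = (enorm xi `^ alpha)%:C *
  cexp (\sum_i (- (z / 2 / 2) * (xi ord0 i)%:C ^+ 2 +
    (0 +i* (x ord0 i - a ord0 i)) * (xi ord0 i)%:C)).
Proof.
rewrite /spectrum mulrCA; congr (_ * _).
rewrite cexp_sum /dotv cis_sum /mwave -big_split /=.
by apply: eq_bigr => i _; rewrite cis_cgauss.
Qed.

Lemma profile_lower_bound : exists delta c0 : R, [/\ 0 < delta, 0 < c0 &
  forall (tau : R) (a x : 'rV[R]_n), `|tau| <= delta ->
    (forall i, `|x ord0 i - a ord0 i| <= delta) ->
    c0 <= cnorm (profile alpha (1 +i* tau) a x)].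
Proof.
(* [4^-1] is the real part of [z / 2 / 2]: one half comes from the diagonal, the other from the
   exponent of [cgauss]. *)
pose w (xi : 'rV[R]_n) := enorm xi `^ alpha * expR (- 4^-1 * enorm xi ^+ 2).
pose g (xi : 'rV[R]_n) : R := enorm xi ^+ 2 + \sum_i `|xi ord0 i|.
pose w1 (xi : 'rV[R]_n) := enorm xi `^ alpha * g xi * expR (- 4^-1 * enorm xi ^+ 2).
have p4 : 0 < 4^-1 :> R by rewrite invr_gt0.
have I0 := integral_weight_gt0 n0 p4 al0; rewrite -/w in I0.
have iw : (leb n).-integrable setT (EFin \o w).
  have g1 (x : 'rV[R]_n) : `|1 : R| <= 1 * (1 + enorm x) ^+ 0 by rewrite normr1 mulr1.
  have := @integrable_weight R n _ 1 alpha 0 (fun=> 1) p4 al0 (measurable_cst _) g1.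
  by rewrite /comp; under eq_fun do rewrite mulr1.
have g0 xi : 0 <= g xi by rewrite addr_ge0 ?sqr_ge0 // sumr_ge0.
have xie (xi : 'rV[R]_n) i : `|xi ord0 i| <= enorm xi.
  rewrite -(@ler_pXn2r _ 2) ?nnegrE ?enorm_ge0 // real_normK ?num_real //.
  by rewrite enorm_sqr (bigD1 i) //= lerDl sumr_ge0 // => j _; rewrite sqr_ge0.
have mg : measurable_fun setT g.
  apply: measurable_funD; first by apply: measurable_funX; exact: measurable_enorm.
  by apply: measurable_sum => i; apply: measurableT_comp => //; exact: measurable_coord_rV.
have gb xi : `|g xi| <= (1 + n%:R) * (1 + enorm xi) ^+ 2.
  rewrite ger0_norm // mulrDl mul1r lerD //.
    by rewrite lerXn2r ?nnegrE ?addr_ge0 ?enorm_ge0 // lerDr.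
  apply: (@le_trans _ _ (\sum_(i < n) (1 + enorm xi) ^+ 2)); last first.
    by rewrite sumr_const card_ord mulr_natl.
  apply: ler_sum => i _; apply: (le_trans (xie xi i)).
  by rewrite (@le_trans _ _ (1 + enorm xi)) ?lerDr // ler_eXnr // lerDl enorm_ge0.
have iw1 : (leb n).-integrable setT (EFin \o w1).
  exact: (@integrable_weight R n _ (1 + n%:R) alpha 2 g p4 al0 mg gb).
set J := (\int[leb n]_x w x)%R in I0.
pose J1 := (\int[leb n]_x w1 x)%R.
have w10 xi : 0 <= w1 xi by rewrite !mulr_ge0 ?powR_ge0 ?expR_ge0.
have J10 : 0 <= J1 by apply: Rintegral_ge0 => xi _.
(* The bound by 1 is for [profile_amplitude]; the other one keeps the loss [delta * J1] below half
   of [J]. *)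
pose delta := Num.min 1 (J / (2 * (1 + J1))).
have d0 : 0 < delta by rewrite lt_min ltr01 divr_gt0 // mulr_gt0 // ltr_pwDl.
have d1 : delta <= 1 by rewrite ge_min lexx.
have dJ : delta * J1 <= J / 2.
  apply: (@le_trans _ _ (J / (2 * (1 + J1)) * J1)).
    by rewrite ler_wpM2r // ge_min lexx orbT.
  rewrite invfM mulrA -mulrA ler_piMr // ?divr_ge0 ?(ltW I0) //.
  by rewrite mulrC ler_pdivrMr ?ltr_pwDl // mul1r lerDr.
exists delta, ((2 * pi) ^- n * (J / 2)); split => //.
  by rewrite mulr_gt0 ?divr_gt0 // invr_gt0 exprn_gt0 // mulr_gt0 // pi_gt0.
move=> tau a x htau hx; set z := 1 +i* tau.
have z0 : 0 < complex.Re z by rewrite /= ltr01.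
rewrite /profile -exprMn cnormM cnormX.
have amp := profile_amplitude (le_trans htau d1); rewrite -/z in amp.
rewrite -[leLHS]mul1r ler_pM //.
- by rewrite mulr_ge0 ?divr_ge0 ?(ltW I0) // invr_ge0 exprn_ge0 // mulr_ge0 // pi_ge0.
- exact: exprn_ege1.
rewrite /inv_fourier cnormM cnorm_real cintegralE.
rewrite ger0_norm ?invr_ge0 ?exprn_ge0 ?mulr_ge0 ?pi_ge0 //.
rewrite ler_wpM2l ?invr_ge0 ?exprn_ge0 ?mulr_ge0 ?pi_ge0 //.
apply: (le_trans _ (Re_le_cnorm _)); apply: (le_trans _ (ler_norm _)).
rewrite /cint /=.
have [ic _] : cintegrable (leb n) (fun xi => cis (dotv x xi) * spectrum alpha z a xi).
  by apply: cintegrable_cis; [exact: measurable_dotv|exact: cintegrable_spectrum].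
apply: (@le_trans _ _ (\int[leb n]_xi (w xi - delta * w1 xi))%R).
  rewrite RintegralB //; last exact: integrable_scale.
  rewrite RintegralZl // -/J -/J1 lerBrDr (le_trans (lerD (lexx _) dJ)) //.
  by rewrite -splitr.
apply: le_Rintegral => //.
  rewrite (_ : EFin \o _ = (fun xi =>
    (EFin \o w) xi - (EFin \o (fun xi => delta * w1 xi)%R) xi)%E) //.
  by apply: integrableB => //; exact: integrable_scale.
move=> xi _; rewrite cis_spectrum cReM Re_cexp cRe_sum cIm_sum.
rewrite [complex.Re _%:C]/= [complex.Im (_ `^ _)%:C]/= mul0r subr0.
have zh : z / 2 / 2 = 4^-1 +i* (tau / 4).
  have -> : z / 2 / 2 = z * (4^-1)%:C by rewrite fmorphV rmorph_nat /z; field.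
  by apply: complexP => /=; field.
rewrite zh; set th := \sum_i complex.Im _.
have -> : \sum_i complex.Re (- (4^-1 +i* (tau / 4)) * (xi ord0 i)%:C ^+ 2 +
    (0 +i* (x ord0 i - a ord0 i)) * (xi ord0 i)%:C) = - 4^-1 * enorm xi ^+ 2.
  rewrite enorm_sqr mulr_sumr; apply: eq_bigr => i _; rewrite -rmorphXn /=; ring.
have hth : `|th| <= delta * g xi.
  have -> : th = - (tau / 4) * enorm xi ^+ 2 + \sum_i (x ord0 i - a ord0 i) * xi ord0 i.
    rewrite enorm_sqr mulr_sumr -big_split; apply: eq_bigr => i _.
    by rewrite -rmorphXn /=; ring.
  rewrite (le_trans (ler_normD _ _)) // mulrDr lerD //.
    rewrite normrM [X in _ * X]ger0_norm ?sqr_ge0 // ler_wpM2r ?sqr_ge0 // normrN normrM.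
    by rewrite (le_trans _ htau) // ler_piMr // ger0_norm ?invr_ge0 // invf_le1 //; lra.
  rewrite (le_trans (ler_norm_sum _ _ _)) // mulr_sumr; apply: ler_sum => i _.
  by rewrite normrM ler_wpM2r.
rewrite /w /w1; set P := enorm xi `^ alpha; set E := expR _.
rewrite (_ : P * E - _ = P * (E * (1 - delta * g xi))); last by ring.
rewrite ler_wpM2l ?powR_ge0 // ler_wpM2l ?expR_ge0 //.
by rewrite (le_trans _ (cos_ge_1B th)) // lerD2l lerN2.
Qed.

End profile_bounds.

(** * Lower bounds for norms and random signs *)

Section norm_duality.
Context {R : realType} d (T : measurableType d) (mu : {measure set T -> \bar R}).
Local Open Scope ereal_scope.
Implicit Types (f g : T -> \bar R).

(** Both integrals are suprema over the simple functions below, so neither function has to be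
    measurable. *)
Lemma ge0_le_integral_minorant f g : (forall x, 0 <= g x) -> (forall x, g x <= f x) ->
  \int[mu]_x g x <= \int[mu]_x f x.
Proof.
move=> g0 gf; have f0 x : 0 <= f x by exact: le_trans (gf x).
rewrite (ge0_integralTE _ g0) (ge0_integralTE _ f0).
apply: ge_ereal_sup => _ [h /= hg <-]; apply: ereal_sup_ubound; exists h => // x.
exact: le_trans (hg x) (gf x).
Qed.

(* [1 - 1/p] with [1/oo = 0]; the value at [-oo] is junk. *)
Definition hoelder_exponent (p : \bar R) : R := (if p is r%:E then 1 - r^-1 else 1)%R.

Lemma le_poweR_young (A : \bar R) (r m : R) : (1 <= r)%R -> (0 < m)%R -> 0 <= A ->
  A <= (m `^ (1 - r))%:E * A `^ r + m%:E.
Proof.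
move=> r1 m0; have r0 : (0 < r)%R by exact: lt_le_trans r1.
case: A => [A||] //; last first.
  move=> _; rewrite poweRyr ?gt_eqF // mulry gtr0_sg ?powR_gt0 // mul1e.
  by rewrite addye // ltNyr.
rewrite lee_fin => A0; rewrite poweR_EFin -EFinM -EFinD lee_fin.
have [Am|mA] := leP A m.
  by apply: le_trans Am _; rewrite lerDr mulr_ge0 ?powR_ge0.
have A0' : (0 < A)%R by exact: lt_trans mA.
apply: (@le_trans _ _ (m `^ (1 - r) * A `^ r)%R); last by rewrite lerDl ltW.
have -> : (m `^ (1 - r) = (m `^ (r - 1))^-1)%R by rewrite -powRN opprB.
rewrite ler_pdivlMl ?powR_gt0 //.
have -> : (A `^ r = A `^ (r - 1) * A)%R.
  by rewrite -[X in (_ * X)%R](powRr1 A0) -powRD ?subrK // (gt_eqF A0') implybT.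
by rewrite ler_wpM2r // ge0_ler_powR ?nnegrE ?subr_ge0 // ltW.
Qed.

Lemma integral_le_Lnorm_aux (X : set T) (v M : R) (p : \bar R) f g :
  1 <= p -> measurable X -> (0 < v)%R -> mu X = v%:E -> (0 < M)%R ->
  measurable_fun setT g -> (forall x, 0 <= g x) -> (forall x, g x <= f x) ->
  'N[mu]_p[f] <= M%:E ->
  \int[mu]_(x in X) g x <= (2 * M * v `^ (hoelder_exponent p))%:E.
Proof.
move=> p1 mX v0 Xv M0 mg g0 gf.
have f0 x : 0 <= f x by exact: le_trans (gf x).
case: p p1 => [r||] //= p1; rewrite ?leNye_eq //.
  rewrite lee_fin in p1; have r0 : (0 < r)%R by exact: lt_le_trans p1.
  move=> NM; have rn0 : (r != 0)%R by rewrite gt_eqF.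
  have Ir : \int[mu]_x g x `^ r <= (M `^ r)%:E.
    apply: (@le_trans _ _ (\int[mu]_x `|f x| `^ r)).
      apply: ge0_le_integral_minorant => x; first exact: poweR_ge0.
      rewrite gee0_abs //; apply: gt0_ler_poweR; last exact: gf.
      - exact: ltW.
      - by rewrite in_itv /= leey andbT.
      - by rewrite in_itv /= leey andbT.
    rewrite -poweR_Lnorm // -poweR_EFin; apply: gt0_ler_poweR => //.
    - exact: ltW.
    - by rewrite in_itv /= leey andbT Lnorm_ge0.
    - by rewrite in_itv /= leey andbT lee_fin ltW.
  pose m := (M * v `^ (- r^-1))%R.
  have m0 : (0 < m)%R by rewrite mulr_gt0 ?powR_gt0.
  have mgr : measurable_fun setT (fun x => g x `^ r).
    exact: (measurableT_comp (measurable_poweR r) mg).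
  apply: (@le_trans _ _ (\int[mu]_(x in X) ((m `^ (1 - r))%:E * g x `^ r + m%:E))).
    apply: ge0_le_integral => //.
    - exact: measurable_funTS.
    - apply: measurable_funTS; apply: emeasurable_funD => //.
      exact: measurable_funeM.
    - by move=> x _; exact: le_poweR_young.
  rewrite ge0_integralD //; last 3 first.
  - by move=> x _; rewrite mule_ge0 ?poweR_ge0 // lee_fin powR_ge0.
  - by apply: measurable_funTS; exact: measurable_funeM.
  - by move=> x _; rewrite lee_fin ltW.
  rewrite ge0_integralZl //; last 3 first.
  - exact: measurable_funTS.
  - by move=> x _; exact: poweR_ge0.
  - by rewrite lee_fin powR_ge0.
  rewrite integral_cst // Xv.
  have IX : \int[mu]_(x in X) g x `^ r <= (M `^ r)%:E.
    apply: le_trans Ir; apply: ge0_subset_integral => // x _; exact: poweR_ge0.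
  apply: (@le_trans _ _ ((m `^ (1 - r))%:E * (M `^ r)%:E + m%:E * v%:E)).
    by rewrite leeD2r // lee_wpmul2l // lee_fin powR_ge0.
  rewrite -!EFinM -EFinD lee_fin le_eqVlt; apply/orP; left; apply/eqP.
  have vE : (v `^ (- r^-1) * v = v `^ (1 - r^-1))%R.
    rewrite -[X in (_ * X)%R](powRr1 (ltW v0)) -powRD; first by rewrite addrC.
    by rewrite (gt_eqF v0) implybT.
  have -> : (m `^ (1 - r) * M `^ r = M * v `^ (1 - r^-1))%R.
    rewrite /m powRM ?powR_ge0 ?(ltW M0) // mulrAC -powRD; last by rewrite (gt_eqF M0) implybT.
    rewrite subrK powRr1 ?(ltW M0) // -powRrM; congr (_ * _ `^ _)%R.
    by field.
  by rewrite /m -vE; ring.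
rewrite unlock /=.
(* The [L^oo] norm is the essential supremum provided that the whole space has positive measure,
   which [X] ensures. *)
have T0 : 0 < mu setT.
  by apply: (@lt_le_trans _ _ (mu X)); [rewrite Xv lte_fin|apply: le_measure; rewrite ?inE].
rewrite T0 => /ess_supP aeM.
apply: (@le_trans _ _ (\int[mu]_(x in X) M%:E)).
  apply: ae_ge0_le_integral => //.
  - exact: measurable_funTS.
  - by move=> x _; rewrite lee_fin ltW.
  - apply: filterS aeM => x /= h _; apply: le_trans h.
    by rewrite gee0_abs.
rewrite integral_cst // Xv -EFinM lee_fin powRr1 ?(ltW v0) //.
by rewrite ler_wpM2r ?(ltW v0) // ler_peMl ?(ltW M0) //; lra.
Qed.

(* [f] need not be measurable: it will be [t |-> 'N_q[F t]], whose measurability is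
   unclear for [q = +oo]. *)
Lemma integral_le_Lnorm (X : set T) (v : R) (p : \bar R) f g :
  1 <= p -> measurable X -> (0 < v)%R -> mu X = v%:E ->
  measurable_fun setT g -> (forall x, 0 <= g x) -> (forall x, g x <= f x) ->
  \int[mu]_(x in X) g x <= (2 * v `^ (hoelder_exponent p))%:E * 'N[mu]_p[f].
Proof.
move=> p1 mX v0 Xv mg g0 gf; set c := (2 * _)%R.
have c0 : (0 < c)%R by rewrite mulr_gt0 ?powR_gt0.
have N0 := Lnorm_ge0 mu p f.
case E : ('N[mu]_p[f]) N0 => [N||] // N0; last first.
  by rewrite mulry gtr0_sg // mul1e leey.
apply/lee_addgt0Pr => e e0; rewrite lee_fin in N0.
(* The norm [N] may vanish while the auxiliary bound wants a positive majorant; the excess [e / c]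
   costs exactly [e]. *)
have M0 : (0 < N + e / c)%R by rewrite ltr_wpDl // divr_gt0.
have := integral_le_Lnorm_aux p1 mX v0 Xv M0 mg g0 gf.
rewrite E lee_fin lerDl divr_ge0 ?(ltW e0) ?(ltW c0) // => /(_ isT) h.
apply: (le_trans h); rewrite -EFinM -EFinD lee_fin le_eqVlt; apply/orP; left; apply/eqP.
rewrite -/c mulrAC -/c mulrDr [(c * (e / c))%R]mulrC divfK ?gt_eqF //.
Qed.

End norm_duality.

(** * Averages over signs *)

Section random_signs.
Context {R : realType} (J : finType).
Implicit Types (e : {ffun J -> bool}) (j k : J).

Definition sgn e j : R := (-1) ^+ e j.

Lemma sgn_sqr e j : sgn e j * sgn e j = 1.
Proof. by rewrite /sgn -expr2 sqrr_sign. Qed.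

(** Flipping the sign at [j] permutes the sign families and negates the summand. *)
Lemma sgn_orthogonal j k : j != k -> \sum_e sgn e j * sgn e k = 0.
Proof.
move=> jk; pose flip e := [ffun i => if i == j then ~~ e i else e i].
have flipK : involutive flip.
  by move=> e; apply/ffunP => i; rewrite !ffunE; case: eqP => // _; rewrite negbK.
set S := \sum_e _; suff h : S = - S.
  by apply/eqP; have := subrr S; rewrite {2}h opprK -mulr2n => /eqP; rewrite mulrn_eq0.
rewrite {1}/S (reindex_inj (inv_inj flipK)) /= -sumrN; apply: eq_bigr => e _.
rewrite /sgn !ffunE eqxx (eq_sym k) (negbTE jk).
by case: (e j) => /=; rewrite ?expr0 ?expr1; ring.
Qed.

Lemma sgn_parseval_real (x : J -> R) :
  \sum_e (\sum_j sgn e j * x j) ^+ 2 = #|{ffun J -> bool}|%:R * \sum_j x j ^+ 2.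
Proof.
transitivity (\sum_e \sum_j \sum_k (sgn e j * sgn e k) * (x j * x k)).
  apply: eq_bigr => e _; rewrite expr2 mulr_suml; apply: eq_bigr => j _.
  by rewrite mulr_sumr; apply: eq_bigr => k _; ring.
rewrite exchange_big mulr_sumr; apply: eq_bigr => j _ /=.
rewrite exchange_big (bigD1 j) //= [X in _ + X]big1 => [|k kj]; last first.
  by rewrite -mulr_suml sgn_orthogonal ?mul0r // eq_sym.
rewrite addr0 -mulr_suml -expr2; congr (_ * _).
by under eq_bigr do rewrite sgn_sqr; rewrite sumr_const.
Qed.

Definition signed_sum e (z : J -> R[i]) : R[i] := \sum_j (sgn e j)%:C * z j.

Lemma sgn_parseval (z : J -> R[i]) :
  \sum_e cnorm (signed_sum e z) ^+ 2 = #|{ffun J -> bool}|%:R * \sum_j cnorm (z j) ^+ 2.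
Proof.
under eq_bigr do rewrite cnorm2 /signed_sum cRe_sum cIm_sum.
under [in RHS]eq_bigr do rewrite cnorm2.
rewrite !big_split /= mulrDr -!sgn_parseval_real; congr (_ + _).
  apply: eq_bigr => e _; congr (_ ^+ 2); apply: eq_bigr => j _.
  by rewrite cReM /= mul0r subr0.
apply: eq_bigr => e _; congr (_ ^+ 2); apply: eq_bigr => j _.
by rewrite cImM /= mul0r addr0.
Qed.

(** Summing [sgn e k] times the signed sum over all [e] isolates [z k] by orthogonality, and the
    triangle inequality finishes. The other terms may be arbitrarily large, so no decay of them is
    asked for. *)
Lemma sgn_lower (z : J -> R[i]) k :
  #|{ffun J -> bool}|%:R * cnorm (z k) <= \sum_e cnorm (signed_sum e z).
Proof.
have E : (#|{ffun J -> bool}|%:R : R)%:C * z k = \sum_e (sgn e k)%:C * signed_sum e z.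
  under eq_bigr do rewrite mulr_sumr.
  rewrite exchange_big /= (bigD1 k) //= [X in _ + X]big1 => [|j jk]; last first.
    under eq_bigr do rewrite mulrA -rmorphM.
    by rewrite -mulr_suml -rmorph_sum sgn_orthogonal ?rmorph0 ?mul0r // eq_sym.
  rewrite addr0; under eq_bigr do rewrite mulrA -rmorphM sgn_sqr rmorph1 mul1r.
  by rewrite sumr_const rmorph_nat mulr_natl.
rewrite -[X in X * _]ger0_norm ?ler0n // -cnorm_real -cnormM E.
apply: (le_trans (cnorm_sum _ _ _)); apply: ler_sum => e _.
rewrite cnormM cnorm_real /sgn normrX normrN1 expr1n mul1r //.
Qed.

End random_signs.

Section signed_packets.
Context {R : realType}.
Variables (n : nat) (s : R).

Let weight (xi : 'rV[R]_(n + n)) : R := (1 + enorm xi ^+ 2) `^ s.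

Let measurable_weight : measurable_fun setT weight.
Proof.
have mp := @measurable_powR R s.
apply: (measurableT_comp mp); apply: measurable_funD => //.
by apply: measurable_funX; exact: measurable_enorm.
Qed.

Let weight_ge0 xi : 0 <= weight xi. Proof. exact: powR_ge0. Qed.

Let weight_bound xi : `|weight xi| <= 1 * (1 + enorm xi) ^+ (2 * (Num.truncn s).+1).
Proof.
rewrite mul1r ger0_norm // exprM.
have e2 : 1 <= 1 + enorm xi ^+ 2 by rewrite lerDl sqr_ge0.
apply: (@le_trans _ _ ((1 + enorm xi ^+ 2) ^+ (Num.truncn s).+1)).
  rewrite -powR_mulrn ?addr_ge0 ?sqr_ge0 // ler_powR //.
  exact/ltW/truncnS_gt.
rewrite lerXn2r ?nnegrE ?addr_ge0 ?sqr_ge0 // sqrrD expr1n mul1r.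
by rewrite addrAC lerDl mulrn_wge0 // enorm_ge0.
Qed.

Definition signed_packet (J : finType) (e : {ffun J -> bool}) (t : J -> R)
    (a : J -> 'rV[R]_n) (v : 'rV[R]_(n + n)) : R[i] :=
  signed_sum e (fun j => packet (1 +i* t j) (a j) v).

(** The modulus of each packet's transform is the same Gaussian whatever its centre, so
    [sgn_parseval] at a fixed frequency sees [#|J|] equal terms. Hence [W], the squared [H^s] norm
    of a single packet, serves all families at once; [E e] is the squared norm for the signs [e]. *)
Lemma sobolev_signed_packets : exists2 W : R, 0 <= W &
  forall (J : finType) (t : J -> R) (a : J -> 'rV[R]_n),
  exists E : {ffun J -> bool} -> R, [/\ (forall e, 0 <= E e),
    (forall e, sobolev_norm s (signed_packet e t a) = (Num.sqrt (E e))%:E) &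
    \sum_e E e = #|{ffun J -> bool}|%:R * (#|J|%:R * W)].
Proof.
pose w xi := weight xi * expR (- 1 * enorm xi ^+ 2).
have iw : (leb (n + n)).-integrable setT (EFin \o w).
  exact: (integrable_poly_gauss ltr01 measurable_weight weight_bound).
have w0 xi : 0 <= w xi by rewrite mulr_ge0 ?expR_ge0.
exists (\int[leb (n + n)]_xi w xi)%R; first by apply: Rintegral_ge0 => xi _.
move=> J t a; set M : R := #|{ffun J -> bool}|%:R.
have z0 j : 0 < complex.Re (1 +i* t j) by rewrite /= ltr01.
pose F e xi := weight xi *
  cnorm (signed_sum e (fun j => mwave (1 +i* t j) (row_mx (a j) (a j)) xi)) ^+ 2.
have F0 e xi : 0 <= F e xi by rewrite mulr_ge0 // sqr_ge0.
have FS xi : \sum_e F e xi = M * (#|J|%:R * w xi).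
  rewrite -mulr_sumr sgn_parseval mulrCA; congr (_ * _).
  have c2 j : cnorm (mwave (1 +i* t j) (row_mx (a j) (a j)) xi) ^+ 2 = expR (- 1 * enorm xi ^+ 2).
    by rewrite cnorm_mwave -expRM_natl /=; congr expR; field.
  under eq_bigr do rewrite c2.
  by rewrite sumr_const -[expR _ *+ _]mulr_natl mulrCA.
have mF e : measurable_fun setT (F e).
  apply: measurable_funM => //; apply: measurable_cnorm2; apply: cmeas_sum => j.
  by apply: cmeasM; [exact: cmeas_cst|exact: cmeas_mwave].
have iF e : (leb (n + n)).-integrable setT (EFin \o F e).
  (* A single nonnegative term is dominated by the sum over all sign families, which [FS]
     evaluates. *)
  apply: (@le_integrableT _ _ _ _ _ (fun xi => (M * #|J|%:R) * w xi)) => //.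
    exact: integrable_scale.
  move=> xi; rewrite ger0_norm // -mulrA -FS (bigD1 e) //= lerDl.
  exact: sumr_ge0.
exists (fun e => (\int[leb (n + n)]_xi F e xi)%R); split.
- by move=> e; apply: Rintegral_ge0.
- move=> e; rewrite /sobolev_norm.
  have -> : (\int[leb (n + n)]_xi ((1 + enorm xi ^+ 2) `^ s *
      cnorm (fourier (signed_packet e t a) xi) ^+ 2)%:E =
      ((2 * pi) ^+ (n + n))%:E * (\int[leb (n + n)]_xi F e xi)%R%:E)%E.
    rewrite fineK; last exact: integrable_fin_num (iF e).
    rewrite -integralZl //; last exact: (iF e).
    apply: eq_integral => xi _.
    rewrite -EFinM; congr EFin; rewrite /F [RHS]mulrCA -/(weight xi).
    congr (weight xi * _).
    rewrite /signed_packet /signed_sum fourier_sum => [|j]; last exact: cintegrable_packet.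
    have -> : \sum_j (sgn e j)%:C * fourier (packet (1 +i* t j) (a j)) xi =
       (2 * pi)%:C ^+ n * signed_sum e (fun j => mwave (1 +i* t j) (row_mx (a j) (a j)) xi).
      rewrite mulr_sumr; apply: eq_bigr => j _.
      by rewrite fourier_packet // mulrCA.
    rewrite cnormM exprMn cnormX cnorm_real ger0_norm ?mulr_ge0 ?pi_ge0 //.
    by rewrite -exprM (_ : (n * 2)%N = (n + n)%N) // muln2 addnn.
  rewrite -!EFinM mulrA mulVf; last first.
    by rewrite expf_neq0 // gt_eqF // mulr_gt0 // pi_gt0.
  by rewrite mul1r poweR_EFin powR12_sqrt //; apply: Rintegral_ge0.
- have RE (f : 'rV[R]_(n + n) -> R) : (leb (n + n)).-integrable setT (EFin \o f) ->
      ((\int[leb (n + n)]_xi f xi)%R%:E = \int[leb (n + n)]_xi (f xi)%:E)%E.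
    by move=> fi; rewrite /Rintegral fineK //; exact: integrable_fin_num fi.
  apply: EFin_inj; rewrite -sumEFin.
  under eq_bigr => e _ do rewrite RE //.
  rewrite -integral_sum //.
  under eq_integral => xi _ do rewrite sumEFin FS mulrA EFinM.
  by rewrite integralZl // -RE // -EFinM mulrA.
Qed.

End signed_packets.

(** * Gaussians are Schwartz functions *)

Section directional_derivative.
Context {R : realType} (n : nat).
Implicit Types (f : 'rV[R]_n -> R) (x v : 'rV[R]_n).

(** Restriction to the line through [x] along [v] transfers the one-variable chain rule, so that
    only directional derivatives ever appear. *)
Lemma is_derive_line f x v (df : R) :
  is_derive x v f df <-> is_derive (0 : R) (1 : R) (fun h : R => f (h *: v + x)) df.
Proof.
have D : 'D_v f x = 'D_(1 : R) (fun h : R => f (h *: v + x)) (0 : R).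
  rewrite /derive; set F := (X in _ = lim (X @ _)).
  suff -> : F = (fun h => h^-1 *: ((f \o shift x) (h *: v) - f x)) by [].
  by apply/funext => h; rewrite /F /= addr0 scale0r add0r [h *: 1]mulr1.
split => -[d e]; apply: DeriveDef.
- exact: (derivable1P f x v).1 d.
- by rewrite -D.
- exact: (derivable1P f x v).2 d.
- by rewrite D.
Qed.

Lemma is_derive_chain (g : R -> R) f x v (dg df : R) :
  is_derive (f x) (1 : R) g dg -> is_derive x v f df ->
  is_derive x v (fun y => g (f y)) (dg * df).
Proof.
move=> hg /is_derive_line hf; apply/is_derive_line.
apply: (is_derive1_comp _ hf); rewrite scale0r add0r; exact: hg.
Qed.

Lemma is_derive_coord x v (i : 'I_n) :
  is_derive x v (fun y : 'rV[R]_n => y ord0 i) (v ord0 i).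
Proof.
apply/is_derive_line.
rewrite (_ : (fun h : R => _) = (fun h : R => h * v ord0 i + x ord0 i)); last first.
  by apply/funext => h; rewrite !mxE.
have h1 : is_derive (0 : R) (1 : R) (fun h : R => v ord0 i * h) (v ord0 i * 1).
  exact: (is_deriveZ (v ord0 i) (is_derive_id (0 : R) (1 : R))).
have h2 : is_derive (0 : R) (1 : R) (fun h : R => x ord0 i) 0 by exact: is_derive_cst.
rewrite (_ : (fun h : R => _) = (fun h : R => v ord0 i * h + x ord0 i)).
  by apply: (is_derive_eq (is_deriveD h1 h2)); rewrite mulr1 addr0.
by apply/funext => h; rewrite mulrC.
Qed.

End directional_derivative.

Section schwartz_gaussians.
Context {R : realType} (n : nat).
Implicit Types (f g : 'rV[R]_n -> R) (x b : 'rV[R]_n).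

Definition sqdist b x : R := \sum_i (x ord0 i - b ord0 i) ^+ 2.

(* Closed under partial derivatives, which is what makes its members Schwartz. *)
Inductive hermite_like : ('rV[R]_n -> R) -> Prop :=
| hermite_cos A B b : 0 < A ->
    hermite_like (fun x => expR (- A * sqdist b x) * cos (B * sqdist b x))
| hermite_sin A B b : 0 < A ->
    hermite_like (fun x => expR (- A * sqdist b x) * sin (B * sqdist b x))
| hermite_add f g : hermite_like f -> hermite_like g ->
    hermite_like (fun x => f x + g x)
| hermite_scale c f : hermite_like f -> hermite_like (fun x => c * f x)
| hermite_coord i f : hermite_like f -> hermite_like (fun x => x ord0 i * f x).

Lemma is_derive_sqdist b x (j : 'I_n) :
  is_derive x (delta_mx ord0 j) (sqdist b) (2 * (x ord0 j - b ord0 j)).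
Proof.
pose h (i : 'I_n) (y : 'rV[R]_n) := (y ord0 i - b ord0 i) ^+ 2.
pose dh (i : 'I_n) : R := 2 * (x ord0 i - b ord0 i) * (delta_mx ord0 j : 'rV[R]_n) ord0 i.
have dhi i : is_derive x (delta_mx ord0 j) (h i) (dh i).
  have d := is_deriveB (is_derive_coord x (delta_mx ord0 j) i)
    (is_derive_cst (b ord0 i) x (delta_mx ord0 j)).
  apply: (is_derive_eq (is_deriveM d d)).
  by rewrite /dh /cst /= !fctE subr0 /GRing.scale /=; ring.
have -> : sqdist b = \sum_(i < n) h i by apply/funext => y; rewrite fct_sumE.
apply: (is_derive_eq (is_derive_sum dhi)).
rewrite (bigD1 j) //= big1 => [|i ij]; rewrite /dh mxE eqxx /=.
  by rewrite eqxx mulr1 addr0.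
by rewrite (negbTE ij) mulr0.
Qed.

Lemma hermite_like_mul_linear f (c d : R) i : hermite_like f ->
  hermite_like (fun x => c * (x ord0 i - d) * f x).
Proof.
move=> hf; rewrite (_ : (fun x => _) = (fun x => c * (x ord0 i * f x) + (- c * d) * f x)).
  by apply: hermite_add; apply: hermite_scale => //; exact: hermite_coord.
by apply/funext => x; ring.
Qed.

Lemma hermite_like_derive f (j : 'I_n) : hermite_like f ->
  exists2 g, hermite_like g & forall x, is_derive x (delta_mx ord0 j) f (g x).
Proof.
have dE A b x : is_derive x (delta_mx ord0 j) (fun x => expR (- A * sqdist b x))
    (expR (- A * sqdist b x) * (- A * (2 * (x ord0 j - b ord0 j)))).
  apply: (is_derive_chain (is_derive_expR _)).
  exact: (is_deriveZ (- A) (is_derive_sqdist b x j)).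
have dC B b x : is_derive x (delta_mx ord0 j) (fun x => cos (B * sqdist b x))
    (- sin (B * sqdist b x) * (B * (2 * (x ord0 j - b ord0 j)))).
  apply: (is_derive_chain (is_derive_cos _)).
  exact: (is_deriveZ B (is_derive_sqdist b x j)).
have dS B b x : is_derive x (delta_mx ord0 j) (fun x => sin (B * sqdist b x))
    (cos (B * sqdist b x) * (B * (2 * (x ord0 j - b ord0 j)))).
  apply: (is_derive_chain (is_derive_sin _)).
  exact: (is_deriveZ B (is_derive_sqdist b x j)).
elim => {f}.
- move=> A B b A0.
  exists (fun x => (- A * 2) * (x ord0 j - b ord0 j) *
      (expR (- A * sqdist b x) * cos (B * sqdist b x))
    + (- B * 2) * (x ord0 j - b ord0 j) * (expR (- A * sqdist b x) * sin (B * sqdist b x))).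
    by apply: hermite_add; apply: hermite_like_mul_linear; constructor.
  move=> x; apply: (is_derive_eq (is_deriveM (dE A b x) (dC B b x))).
  by rewrite /GRing.scale /=; ring.
- move=> A B b A0.
  exists (fun x => (- A * 2) * (x ord0 j - b ord0 j) *
      (expR (- A * sqdist b x) * sin (B * sqdist b x))
    + (B * 2) * (x ord0 j - b ord0 j) * (expR (- A * sqdist b x) * cos (B * sqdist b x))).
    by apply: hermite_add; apply: hermite_like_mul_linear; constructor.
  move=> x; apply: (is_derive_eq (is_deriveM (dE A b x) (dS B b x))).
  by rewrite /GRing.scale /=; ring.
- move=> f g _ [f' hf df] _ [g' hg dg]; exists (fun x => f' x + g' x).
    exact: hermite_add.
  by move=> x; exact: is_deriveD.
- move=> c f _ [f' hf df]; exists (fun x => c * f' x); first exact: hermite_scale.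
  by move=> x; exact: (is_deriveZ c (df x)).
- move=> i f hf [f' hf' df].
  exists (fun x => x ord0 i * f' x + (delta_mx ord0 j : 'rV[R]_n) ord0 i * f x).
    by apply: hermite_add; [exact: hermite_coord|exact: hermite_scale].
  move=> x; apply: (is_derive_eq (is_deriveM (is_derive_coord x (delta_mx ord0 j) i) (df x))).
  by rewrite /GRing.scale /=; ring.
Qed.

(** A coordinate factor costs one power of [1 + enorm x], so the induction carries all [k] at
    once. *)
Lemma hermite_like_bound f : hermite_like f ->
  forall k : nat, exists C, forall x, (1 + enorm x) ^+ k * `|f x| <= C.
Proof.
have e1 x : 0 <= 1 + enorm x by rewrite addr_ge0 // enorm_ge0.
have base A b (h : 'rV[R]_n -> R) k : 0 < A -> (forall x, `|h x| <= 1) ->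
    exists C, forall x, (1 + enorm x) ^+ k * `|expR (- A * sqdist b x) * h x| <= C.
  move=> A0 h1; have A20 : 0 < A / 2 by rewrite divr_gt0.
  have [C C0 hC] := expR_sqr_bound 0 k A20.
  exists (C * expR (A * enorm b ^+ 2)) => x.
  rewrite normrM (ger0_norm (expR_ge0 _)).
  (* Coordinatewise, the exponents differ by the square [A / 2 * (x_i - 2 * b_i) ^+ 2]. *)
  have hE : expR (- A * sqdist b x) <= expR (- (A / 2) * enorm x ^+ 2) * expR (A * enorm b ^+ 2).
    rewrite -expRD ler_expR !enorm_sqr !mulr_sumr -big_split /=; apply: ler_sum => i _.
    rewrite -subr_ge0 (_ : _ - _ = A / 2 * (x ord0 i - 2 * b ord0 i) ^+ 2); last by field.
    by rewrite mulr_ge0 ?sqr_ge0 // ltW.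
  apply: (@le_trans _ _ ((1 + enorm x) ^+ k *
    (expR (- (A / 2) * enorm x ^+ 2) * expR (A * enorm b ^+ 2)))).
    by rewrite ler_wpM2l ?exprn_ge0 // -[leRHS]mulr1; apply: ler_pM.
  rewrite mulrA ler_wpM2r ?expR_ge0 //.
  have := hC _ (enorm_ge0 x); rewrite mul0r addr0 => h2; apply: (le_trans h2).
  rewrite ler_piMr ?(ltW C0) // -[leRHS]expR0 ler_expR mulNr oppr_le0 mulr_ge0 ?sqr_ge0 //.
  by rewrite ltW // divr_gt0.
elim => {f}.
- by move=> A B b A0 k; apply: base => // x; exact: cos_max.
- by move=> A B b A0 k; apply: base => // x; exact: sin_max.
- move=> f g _ hf _ hg k; have [C hC] := hf k; have [D hD] := hg k; exists (C + D) => x.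
  apply: (@le_trans _ _ ((1 + enorm x) ^+ k * (`|f x| + `|g x|))).
    by rewrite ler_wpM2l ?exprn_ge0 // ler_normD.
  by rewrite mulrDr lerD.
- move=> c f _ hf k; have [C hC] := hf k; exists (`|c| * C) => x.
  by rewrite normrM mulrCA ler_wpM2l.
- move=> i f _ hf k; have [C hC] := hf k.+1; exists C => x; apply: le_trans (hC x).
  rewrite exprSr normrM mulrA ler_wpM2r // ler_wpM2l ?exprn_ge0 //.
  have : `|x ord0 i| <= enorm x.
    rewrite -(@ler_pXn2r _ 2) ?nnegrE ?enorm_ge0 // real_normK ?num_real //.
    by rewrite enorm_sqr (bigD1 i) //= lerDl sumr_ge0 // => l _; rewrite sqr_ge0.
  by move/le_trans; apply; rewrite lerDr.
Qed.

Lemma hermite_like_partials f js : hermite_like f -> hermite_like (partials js f).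
Proof.
elim: js => //= j js IH hf; have [g hg dg] := hermite_like_derive j (IH hf).
rewrite (_ : (fun _ => _) = g) //; apply/funext => x.
by have [_ ->] := dg x.
Qed.

Lemma hermite_like_schwartz f : hermite_like f -> schwartz_real f.
Proof.
move=> hf; split.
  move=> js j x; have [g _ dg] := hermite_like_derive j (hermite_like_partials js hf).
  by have [] := dg x.
move=> js k; exact: (hermite_like_bound (hermite_like_partials js hf)).
Qed.

Lemma hermite_like0 : hermite_like (fun=> 0).
Proof.
rewrite (_ : (fun _ => _) = (fun x => 0 * (expR (- 1 * sqdist 0 x) * cos (0 * sqdist 0 x)))).
  by apply: hermite_scale; exact: hermite_cos.
by apply/funext => x; rewrite mul0r.
Qed.

Lemma hermite_like_sum (J : finType) (F : J -> 'rV[R]_n -> R) :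
  (forall j, hermite_like (F j)) -> hermite_like (fun x => \sum_j F j x).
Proof.
move=> hF; elim: (index_enum J) => [|j r IH].
  by under eq_fun do rewrite big_nil; exact: hermite_like0.
by under eq_fun do rewrite big_cons; exact: hermite_add.
Qed.

Lemma hermite_like_gaussian (c z : R[i]) b : 0 < complex.Re z ->
  hermite_like (fun x => complex.Re (c * mpulse z b x)) /\
  hermite_like (fun x => complex.Im (c * mpulse z b x)).
Proof.
move=> z0; pose w := (2 * z)^-1; pose A := complex.Re w; pose B := - complex.Im w.
have A0 : 0 < A.
  rewrite /A /w cReV_gt0 // (_ : 2 * z = z + z); last by ring.
  by rewrite cReD addr_gt0.
have mE x : mpulse z b x = cexp ((- A * sqdist b x) +i* (B * sqdist b x)).
  rewrite /mpulse -cexp_sum; congr cexp.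
  rewrite (_ : _ +i* _ = - (w * (sqdist b x)%:C)); last first.
    by rewrite /A /B; case: (w) => p q; apply: complexP => /=; ring.
  rewrite rmorph_sum mulr_sumr sumrN; congr (- _); apply: eq_bigr => i _.
  by rewrite rmorphXn /= mulrC.
split.
  rewrite (_ : (fun x => _) = (fun x =>
     complex.Re c * (expR (- A * sqdist b x) * cos (B * sqdist b x)) +
     - complex.Im c * (expR (- A * sqdist b x) * sin (B * sqdist b x)))).
    by apply: hermite_add; apply: hermite_scale; constructor.
  by apply/funext => x; rewrite mE cReM Re_cexp Im_cexp /= !mulNr.
rewrite (_ : (fun x => _) = (fun x =>
   complex.Re c * (expR (- A * sqdist b x) * sin (B * sqdist b x)) +
   complex.Im c * (expR (- A * sqdist b x) * cos (B * sqdist b x)))).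
  by apply: hermite_add; apply: hermite_scale; constructor.
by apply/funext => x; rewrite mE cImM Re_cexp Im_cexp.
Qed.

End schwartz_gaussians.

Lemma schwartz_signed_packet {R : realType} n (J : finType) (e : {ffun J -> bool})
    (t : J -> R) (a : J -> 'rV[R]_n) : schwartz (signed_packet e t a).
Proof.
have z0 j : 0 < complex.Re (1 +i* t j) by rewrite /= ltr01.
have H j := hermite_like_gaussian ((sgn e j)%:C * (1 +i* t j)^-1 ^+ n) (row_mx (a j) (a j)) (z0 j).
rewrite /schwartz /signed_packet /signed_sum; split; apply: hermite_like_schwartz.
  under eq_fun do rewrite cRe_sum; apply: hermite_like_sum => j.
  by under eq_fun do rewrite /packet mulrA; exact: (H j).1.
under eq_fun do rewrite cIm_sum; apply: hermite_like_sum => j.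
by under eq_fun do rewrite /packet mulrA; exact: (H j).2.
Qed.

(** * The main estimate *)

Section counting.
Context {R : realType}.

Lemma cover_segment (delta y : R) (N : nat) : 0 < delta -> (0 < N)%N ->
  0 <= y <= N%:R * delta -> exists j : 'I_N, `|y - (j : nat)%:R * delta| <= delta.
Proof.
move=> d0 N0 /andP[y0 yN]; pose k := Num.truncn (y / delta).
have yd0 : 0 <= y / delta by rewrite divr_ge0 // ltW.
have /andP[k1 k2] := truncn_itv yd0; rewrite -/k in k1 k2.
have [kN|Nk] := ltnP k N.
  exists (Ordinal kN) => /=; rewrite ler_pdivlMr // in k1; rewrite ltr_pdivrMr // in k2.
  rewrite ger0_norm ?subr_ge0 // lerBlDl (le_trans (ltW k2)) //.
  by rewrite -natr1 mulrDl mul1r.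
(* Only the right endpoint [y = N * delta] is left; it lies at distance exactly [delta] from the
   last centre. *)
have N1 : (N.-1 < N)%N by rewrite prednK.
exists (Ordinal N1) => /=.
have NE : N%:R = N.-1%:R + 1 :> R by rewrite natr1 prednK.
have yE : y = N%:R * delta.
  apply/eqP; rewrite eq_le yN /= -ler_pdivlMr //.
  by apply: le_trans k1; rewrite ler_nat.
by rewrite yE NE mulrDl mul1r addrAC subrr add0r ger0_norm // ltW.
Qed.

(** The left side grows like [N] and the right side like [N] to the power [1/2 + 1 - 1/r], which is
    smaller when [r < 2]. One lemma serves both exponents: [N * A] is the measure of the growing
    factor of [T x X] and [B] that of the fixed one. *)
Lemma no_subcritical_growth (r A B D h : R) : 1 <= r -> r < 2 -> 0 < A -> 0 < B ->
  ~ forall N : nat, (0 < N)%N ->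
    (N%:R * A) * B <= D * Num.sqrt N%:R * (N%:R * A) `^ (1 - r^-1) * B `^ h.
Proof.
move=> r1 r2 A0 B0 H; have r0 : 0 < r by exact: lt_le_trans r1.
pose gam := r^-1 - 2^-1.
have g0 : 0 < gam by rewrite subr_gt0 ltf_pV2 ?posrE.
pose D1 := `|D| * B `^ h / B / A `^ r^-1.
have D10 : 0 <= D1 by rewrite !divr_ge0 ?mulr_ge0 ?powR_ge0 // ltW.
have H1 (N : nat) : (0 < N)%N -> N%:R `^ gam <= D1.
  move=> N0; have N0' : 0 < N%:R :> R by rewrite ltr0n.
  have NA : 0 < N%:R * A by rewrite mulr_gt0.
  have := H N N0; rewrite -(powR12_sqrt (ltW N0')) => h1.
  have h2 : (N%:R * A) * B <= `|D| * N%:R `^ 2^-1 * (N%:R * A) `^ (1 - r^-1) * B `^ h.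
    apply: (le_trans h1); rewrite ler_wpM2r ?powR_ge0 // ler_wpM2r ?powR_ge0 //.
    by rewrite ler_wpM2r ?powR_ge0 // ler_norm.
  have e1 : N%:R * A = (N%:R * A) `^ (1 - r^-1) * (N%:R `^ r^-1 * A `^ r^-1).
    rewrite -(powRM _ (ltW N0') (ltW A0)) -powRD; last by rewrite (gt_eqF NA) implybT.
    by rewrite subrK (powRr1 (ltW NA)).
  have e2 : N%:R `^ r^-1 = N%:R `^ gam * N%:R `^ 2^-1.
    by rewrite -powRD ?subrK // (gt_eqF N0') implybT.
  rewrite {1}e1 e2 in h2.
  have p1 : 0 < (N%:R * A) `^ (1 - r^-1) by rewrite powR_gt0.
  have p2 : 0 < N%:R `^ 2^-1 :> R by rewrite powR_gt0.
  rewrite /D1 ler_pdivlMr ?powR_gt0 // ler_pdivlMr //.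
  rewrite -(ler_pM2l (mulr_gt0 p1 p2)); apply: le_trans (le_trans h2 _).
    by rewrite le_eqVlt; apply/orP; left; apply/eqP; ring.
  by rewrite le_eqVlt; apply/orP; left; apply/eqP; ring.
pose y := (D1 + 1) `^ gam^-1.
have yN := truncnS_gt y.
have := H1 (Num.truncn y).+1 isT; rewrite leNgt => /negP; apply.
apply: (@lt_le_trans _ _ (D1 + 1)); first by rewrite ltrDl.
have -> : D1 + 1 = y `^ gam.
  by rewrite /y -powRrM mulVf ?gt_eqF // powRr1 // addr_ge0.
by rewrite ge0_ler_powR ?nnegrE ?powR_ge0 ?(ltW g0) // ltW.
Qed.

(** In place of Cauchy-Schwarz, [sqrt E <= E / S + S] with [S = sqrt N], by comparing [sqrt E] with
    [S]. The price is [W + 1] where the sharp constant would be [sqrt W]. *)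
Lemma sum_sqrt_le (I : finType) (E : I -> R) (W : R) (N : nat) : (0 < N)%N ->
  (forall e, 0 <= E e) -> \sum_e E e = #|I|%:R * (N%:R * W) ->
  \sum_e Num.sqrt (E e) <= #|I|%:R * ((W + 1) * Num.sqrt N%:R).
Proof.
move=> N0 E0 EW; set S := Num.sqrt N%:R.
have S0 : 0 < S by rewrite sqrtr_gt0 ltr0n.
have SS : S * S = N%:R by rewrite -expr2 sqr_sqrtr.
apply: (@le_trans _ _ (\sum_e (E e / S + S))).
  apply: ler_sum => e _; set x := Num.sqrt (E e).
  have x0 : 0 <= x by exact: sqrtr_ge0.
  have -> : E e = x * x by rewrite -expr2 sqr_sqrtr.
  have [xS|Sx] := leP x S; first by rewrite ler_wpDl // divr_ge0 ?mulr_ge0 // ltW.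
  rewrite ler_wpDr ?(ltW S0) // ler_pdivlMr // ler_wpM2l // ltW //.
rewrite big_split /= -mulr_suml EW sumr_const -[S *+ _]mulr_natl -SS.
rewrite le_eqVlt; apply/orP; left; apply/eqP; field; exact: lt0r_neq0.
Qed.

End counting.

Section main_estimate.
Context {R : realType}.
Notation mu := (@lebesgue_measure R).
Variables (n : nat) (p q : \bar R) (alpha s K : R).
Hypotheses (n0 : (0 < n)%N) (p1 : (1 <= p)%E) (q1 : (1 <= q)%E)
  (al0 : 0 <= alpha).
Hypothesis estimate : forall Lambda0 : 'rV[R]_(n + n) -> R[i], schwartz Lambda0 ->
  (mixed_norm p q
     (fun t => abs_nabla alpha (on_diagonal (schrodinger t Lambda0)))
   <= K%:E * sobolev_norm s Lambda0)%E.

(** An explicit form, via [waveE], of the modulus inside the mixed norm for a signed packet; unlike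
    the iterated Fourier integrals it is readily seen to be jointly measurable. *)
Let wave (J : finType) (e : {ffun J -> bool}) (t : J -> R) (a : J -> 'rV[R]_n)
    (z : measurableTypeR R * 'rV[R]_n) : R :=
  cnorm (signed_sum e (fun j => profile alpha (1 +i* (t j + z.1)) (a j) z.2)).

Let waveE (J : finType) (e : {ffun J -> bool}) t a tau (x : 'rV[R]_n) :
  cnorm (abs_nabla alpha (on_diagonal (schrodinger tau (signed_packet e t a))) x) =
  wave e t a (tau, x).
Proof.
have z0 (j : J) : 0 < complex.Re (1 +i* t j) by rewrite /= ltr01.
have zt0 (j : J) : 0 < complex.Re (1 +i* t j + (0 +i* tau)) by rewrite Re_shift.
have SE := @schrodinger_packets R n J (fun j => (sgn e j)%:C) (fun j => 1 +i* t j) a tau z0.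
have AE := @abs_nabla_packets R n alpha J (fun j => (sgn e j)%:C)
  (fun j => 1 +i* t j + (0 +i* tau)) a x al0 zt0.
rewrite -[signed_packet e t a]/(fun v => \sum_j (sgn e j)%:C * packet (1 +i* t j) (a j) v).
rewrite SE AE.
congr cnorm; apply: eq_bigr => j _; congr (_ * profile _ _ _ _).
by apply: complexP; rewrite /= ?addr0.
Qed.

Let measurable_wave J e t a : measurable_fun setT (@wave J e t a).
Proof.
apply: measurable_cnorm; apply: cmeas_sum => j; apply: cmeasM; first exact: cmeas_cst.
apply: cmeas_profile; last exact: measurable_snd.
split => /=; first exact: measurable_cst.
by apply: measurable_funD => //; exact: measurable_fst.
Qed.

Let wave_ge0 J e t a z : 0 <= @wave J e t a z.
Proof. exact: cnorm_ge0. Qed.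

Lemma integral_wave_measurable J e t a (X : set 'rV[R]_n) : measurable X ->
  measurable_fun setT (fun tau : measurableTypeR R =>
    (\int[leb n]_(x in X) (@wave J e t a (tau, x))%:E)%E).
Proof.
move=> mX.
pose h (z : measurableTypeR R * 'rV[R]_n) : \bar R := (@wave J e t a z * \1_X z.2)%:E.
have hE tau : (\int[leb n]_(x in X) (@wave J e t a (tau, x))%:E =
    \int[leb n]_x h (tau, x))%E.
  rewrite integral_mkcond; apply: eq_integral => x _; rewrite /patch /h indicE /=.
  by case: ifP; rewrite ?mulr1 ?mulr0.
under eq_fun do rewrite hE.
apply: (measurable_fun_fubini_tonelli_F (m2 := leb n) h); last first.
  by move=> z; rewrite lee_fin mulr_ge0.
apply/measurable_EFinP; apply: measurable_funM => //.
exact: (measurableT_comp (measurable_indic mX) measurable_snd).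
Qed.

(** [integral_le_Lnorm] is used twice, in [x] at fixed time and then in time, whence [4 = 2 * 2].
    The sign of [K] is not prescribed, which accounts for its absolute value. *)
Lemma integral_wave_le (J : finType) (e : {ffun J -> bool}) t a
    (T : set (measurableTypeR R)) (X : set 'rV[R]_n) (vT vX E : R) :
  measurable T -> measurable X -> 0 < vT -> 0 < vX -> mu T = vT%:E -> leb n X = vX%:E ->
  0 <= E -> sobolev_norm s (signed_packet e t a) = E%:E ->
  (\int[mu]_(tau in T) \int[leb n]_(x in X) (wave e t a (tau, x))%:E <=
   (4 * vT `^ hoelder_exponent p * vX `^ hoelder_exponent q * `|K| * E)%:E)%E.
Proof.
move=> mT mX vT0 vX0 muT muX E0 sobE.
have := estimate (schwartz_signed_packet e t a).
rewrite sobE -EFinM /mixed_norm => H.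
pose cX := 2 * vX `^ hoelder_exponent q.
have cX0 : 0 < cX by rewrite mulr_gt0 ?powR_gt0.
pose G (tau : measurableTypeR R) := (\int[leb n]_(x in X) (wave e t a (tau, x))%:E)%E.
have mG : measurable_fun setT G by exact: integral_wave_measurable.
have G0 tau : (0 <= G tau)%E by apply: integral_ge0 => x _; rewrite lee_fin.
pose F tau := abs_nabla alpha (on_diagonal (schrodinger tau (signed_packet e t a))).
pose Nq (tau : measurableTypeR R) := ('N[leb n]_q [ (fun x => (cnorm (F tau x))%:E) ])%E.
(* The scaled integral over [X] is a measurable minorant of the inner norm [Nq], so the outer
   application does not ask for measurability of [Nq]. *)
have GN tau : (cX^-1%:E * G tau <= Nq tau)%E.
  rewrite lee_pdivrMl //; apply: integral_le_Lnorm => //.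
  - apply/measurable_EFinP; exact: (measurable_fun_pair2 tau (measurable_wave _ _ _)).
  - by move=> x; rewrite lee_fin.
  - by move=> x; rewrite /F waveE.
have := @integral_le_Lnorm R _ _ mu T vT p Nq (fun tau => cX^-1%:E * G tau)%E p1 mT vT0 muT.
move=> /(_ _ _ GN) h.
have cV0 : (0 <= cX^-1%:E :> \bar R)%E by rewrite lee_fin invr_ge0 ltW.
have {}h := h (measurable_funeM _ mG) (fun tau => mule_ge0 cV0 (G0 tau)).
rewrite ge0_integralZl // in h; last exact: measurable_funTS.
rewrite lee_pdivrMl // in h.
apply: (le_trans h).
apply: (@le_trans _ _ (cX%:E * ((2 * vT `^ hoelder_exponent p)%:E * (`|K| * E)%:E)))%E.
  rewrite lee_wpmul2l ?lee_fin ?(ltW cX0) // lee_wpmul2l ?lee_fin ?mulr_ge0 ?powR_ge0 //.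
  by apply: (le_trans H); rewrite lee_fin ler_wpM2r // ler_norm.
rewrite -!EFinM lee_fin le_eqVlt; apply/orP; left; apply/eqP; rewrite /cX; ring.
Qed.

(** The sum over signs of the integrals over [T x X] is bounded above by [integral_wave_le] and
    [sum_sqrt_le], and below pointwise by the packet whose neighbourhood contains the point. The
    number of sign families appears on both sides and cancels, so [delta] and [D] do not depend on
    [N]. *)
Lemma main_estimate : exists delta D : R, 0 < delta /\
  forall (N : nat) (t : 'I_N -> R) (a : 'I_N -> 'rV[R]_n)
    (T : set (measurableTypeR R)) (X : set 'rV[R]_n) (vT vX : R), (0 < N)%N ->
  measurable T -> measurable X -> 0 < vT -> 0 < vX -> mu T = vT%:E -> leb n X = vX%:E ->
  (forall tau x, T tau -> X x -> exists j, `|t j + tau| <= delta /\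
     forall i, `|x ord0 i - a j ord0 i| <= delta) ->
  vT * vX <= D * Num.sqrt N%:R * vT `^ hoelder_exponent p * vX `^ hoelder_exponent q.
Proof.
have [delta [c0 [d0 c00 lower]]] := profile_lower_bound n0 al0.
have [W W0 sob] := @sobolev_signed_packets R n s.
exists delta, (4 * `|K| * (W + 1) / c0); split => //.
move=> N t a T X vT vX N0 mT mX vT0 vX0 muT muX cover.
have [E [E0 sobE sumE]] := sob _ t a.
set M : R := #|{ffun 'I_N -> bool}|%:R in sumE.
have M0 : 0 < M by rewrite ltr0n; apply/card_gt0P; exists [ffun=> true].
rewrite card_ord in sumE.
have sumS := sum_sqrt_le N0 E0 sumE; rewrite -/M in sumS.
pose c := 4 * vT `^ hoelder_exponent p * vX `^ hoelder_exponent q * `|K|.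
have cc0 : 0 <= c by rewrite !mulr_ge0 ?powR_ge0.
have up : (\sum_e \int[mu]_(tau in T) \int[leb n]_(x in X) (wave e t a (tau, x))%:E <=
    (c * (M * ((W + 1) * Num.sqrt N%:R)))%:E)%E.
  apply: (@le_trans _ _ (\sum_(e : {ffun 'I_N -> bool}) (c * Num.sqrt (E e))%:E)%E).
    apply: lee_sum => e _; apply: integral_wave_le => //.
  by rewrite sumEFin lee_fin -mulr_sumr ler_wpM2l.
have mG e : measurable_fun T (fun tau : measurableTypeR R =>
    (\int[leb n]_(x in X) (wave e t a (tau, x))%:E)%E).
  by apply: measurable_funTS; exact: integral_wave_measurable.
have low : ((M * c0 * vX * vT)%:E <=
   \sum_e \int[mu]_(tau in T) \int[leb n]_(x in X) (wave e t a (tau, x))%:E)%E.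
  rewrite -ge0_integral_sum //; last by move=> e tau _; apply: integral_ge0 => x _; rewrite lee_fin.
  apply: (@le_trans _ _ (\int[mu]_(tau in T) (M * c0 * vX)%:E)%E).
    by rewrite integral_cst //= muT EFinM.
  apply: ge0_le_integral => //.
  - by move=> tau _; rewrite lee_fin !mulr_ge0 // ltW.
  - exact: emeasurable_sum.
  move=> tau Ttau; rewrite -ge0_integral_sum //.
  - apply: (@le_trans _ _ (\int[leb n]_(x in X) (M * c0)%:E)%E).
      by rewrite integral_cst // [X in (_ <= _ * X)%E](_ : _ = vX%:E) // EFinM.
    apply: ge0_le_integral => //.
    + by move=> x _; rewrite lee_fin mulr_ge0 // ltW.
    + apply: emeasurable_sum => e; apply: measurable_funTS; apply/measurable_EFinP.
      exact: (measurable_fun_pair2 tau (measurable_wave _ _ _)).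
    + move=> x Xx; rewrite sumEFin lee_fin.
      have [j [tj xj]] := cover _ _ Ttau Xx.
      apply: le_trans (sgn_lower (fun j => profile alpha (1 +i* (t j + tau)) (a j) x) j).
      by rewrite ler_pM2l //; exact: lower.
  - move=> e; apply: measurable_funTS; apply/measurable_EFinP.
    exact: (measurable_fun_pair2 tau (measurable_wave _ _ _)).
  - by move=> e x _; rewrite lee_fin.
have := le_trans low up; rewrite lee_fin => h.
rewrite -(ler_pM2l (mulr_gt0 M0 c00)) -subr_ge0.
rewrite -subr_ge0 in h; apply: le_trans h _.
rewrite le_eqVlt; apply/orP; left; apply/eqP; rewrite /c; field; exact: lt0r_neq0.
Qed.

End main_estimate.

(** * Consecutive translates in time and in space *)

Section conclusion.
Context {R : realType}.
Notation mu := (@lebesgue_measure R).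

Lemma lebesgue_segment (c : R) : 0 < c -> mu `[0, c]%classic = c%:E.
Proof. by move=> c0; rewrite lebesgue_measure_itv /= lte_fin c0 oppr0 adde0. Qed.

Lemma leb_pos_box n (c : 'rV[R]_n) : (forall i, 0 <= c ord0 i) ->
  leb n (box 0 c) = (\prod_i c ord0 i)%:E.
Proof.
move=> c0; rewrite leb_box => [|i]; last by rewrite mxE.
by congr EFin; apply: eq_bigr => i _; rewrite mxE subr0.
Qed.

Lemma exponent_lt2 (p : \bar R) : (1 <= p)%E -> ~ (2 <= p)%E ->
  exists r : R, [/\ p = r%:E, 1 <= r & r < 2].
Proof.
case: p => [r||] //=; last by move=> _ /negP; rewrite leey.
by rewrite !lee_fin => r1 /negP; rewrite -ltNge => r2; exists r.
Qed.

End conclusion.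

Theorem theorem1p1 (R : realType) (n : nat) (p q : \bar R) (alpha s : R) :
  (1 <= n)%N -> (1 <= p)%E -> (1 <= q)%E -> 0 <= alpha -> 0 <= s ->
  (exists K : R, forall Lambda0 : 'rV[R]_(n + n) -> R[i], schwartz Lambda0 ->
    (mixed_norm p q
       (fun t => abs_nabla alpha (on_diagonal (schrodinger t Lambda0)))
     <= K%:E * sobolev_norm s Lambda0)%E) ->
  (2 <= p)%E /\ (2 <= q)%E.
Proof.
move=> n0 p1 q1 al0 _ [K estimate].
have [delta [D [d0 main]]] := main_estimate n0 p1 q1 al0 estimate.
split; apply: contrapT => lt2.
- have [r [pE r1 r2]] := exponent_lt2 p1 lt2.
  pose c : 'rV[R]_n := const_mx delta.
  have cE i : c ord0 i = delta by rewrite mxE.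
  have B0 : 0 < \prod_i c ord0 i by apply: prodr_gt0 => i _; rewrite cE.
  apply: (@no_subcritical_growth R r delta (\prod_i c ord0 i) D (hoelder_exponent q)) => // N N0.
  have NA : 0 < N%:R * delta by rewrite mulr_gt0 // ltr0n.
  (* The minus sign places the centre of packet [j] at time [j * delta], since it is focused when
     [t j + tau = 0]. *)
  have := main N (fun j => - (nat_of_ord j)%:R * delta) (fun=> 0)
    `[0, N%:R * delta]%classic (box 0 c) _ _ N0 (measurable_itv _) (measurable_box _ _)
    NA B0 (lebesgue_segment NA) (leb_pos_box _).
  rewrite pE; apply => [i|tau x]; first by rewrite cE ltW.
  rewrite /= in_itv /= => /(cover_segment d0 N0)[j hj] hx; exists j.
  split; first by rewrite addrC mulNr.
  by move=> i; have := hx i; rewrite cE !mxE subr0 => /andP[x0 xd]; rewrite ger0_norm.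
- have [r [qE r1 r2]] := exponent_lt2 q1 lt2.
  pose i0 := Ordinal n0.
  apply: (@no_subcritical_growth R r (delta ^+ n) delta D (hoelder_exponent p)) => //.
    exact: exprn_gt0.
  move=> N N0; have NA : 0 < N%:R * delta ^+ n by rewrite mulr_gt0 ?ltr0n // exprn_gt0.
  (* Only one coordinate is stretched, so [N] packets suffice and the volume stays linear in [N]; in
     the other coordinates the box lies within [delta] of the common centre. *)
  pose c : 'rV[R]_n := \row_i ((if i == i0 then N%:R else 1) * delta).
  have c0 i : 0 <= c ord0 i.
    by rewrite mxE; case: ifP => _; rewrite mulr_ge0 // ltW.
  have cE : \prod_i c ord0 i = N%:R * delta ^+ n.
    under eq_bigr do rewrite mxE.
    rewrite big_split /= prodr_const card_ord; congr (_ * _).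
    by rewrite -big_mkcond big_pred1_eq.
  have muX := leb_pos_box c0; rewrite cE in muX.
  (* Time and space exchange roles: here the growing factor is the measure of [X]. *)
  rewrite [leLHS]mulrC [leRHS]mulrAC.
  have := main N (fun=> 0) (fun j => (nat_of_ord j)%:R *: (delta *: delta_mx ord0 i0))
    `[0, delta]%classic (box 0 c) _ _ N0 (measurable_itv _) (measurable_box _ _)
    d0 NA (lebesgue_segment d0) muX.
  rewrite qE; apply => tau x.
  rewrite /= in_itv /= => /andP[t0 td] hx.
  have := hx i0; rewrite !mxE eqxx => /(cover_segment d0 N0)[j hj].
  exists j; split; first by rewrite add0r ger0_norm.
  move=> i; rewrite !mxE eqxx /=; have [->|ii0] := eqVneq i i0; first by rewrite mulr1.
  have := hx i; rewrite !mxE (negbTE ii0) mul1r !mulr0 subr0 => /andP[x0 xd].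
  by rewrite ger0_norm.
Qed.
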